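(* For every integer $t\ge 2$ and every real $\delta>0$ there exists $\Delta_0=\Delta_0(t,\delta)$ such that every tree $T$ with maximum degree $\Delta(T)=\Delta\ge\Delta_0$ satisfies \[ \tau_t(T)\le (1+\delta)\sqrt{t(t-1)\Delta}. \]
   Context: For an integer $t\ge1$, a $t$-tone coloring of a graph $G$ assigns to each vertex $v$ a set $f(v)$ of exactly $t$ colors from a color set $C$ such that $|f(u)\cap f(v)|<d(u,v)$ for all distinct vertices $u,v$, where $d(u,v)$ is the graph distance. The $t$-tone chromatic number $\tau_t(G)$ is the minimum $|C|$ over all $t$-tone colorings of $G$. *)

(* Defs.v *)
From mathcomp Require Import all_boot all_order all_algebra reals.

Set Implicit Arguments.
Unset Strict Implicit.
Unset Printing Implicit Defensive.

Section Graph.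

Variables (V : finType) (e : rel V).

Definition simple_graph : Prop := symmetric e /\ irreflexive e.

Definition connected_graph : Prop := 0 < #|V| /\ forall u v, connect e u v.

(* A cycle of a simple graph is a closed walk through at least three pairwise
   distinct vertices; [c] lists them once each. *)
Definition acyclic_graph : Prop :=
  forall c : seq V, 3 <= size c -> ~ ucycle e c.

Definition is_tree : Prop :=
  [/\ simple_graph, connected_graph & acyclic_graph].

Definition degree (v : V) : nat := #|[set w | e v w]|.

Definition max_degree : nat := \max_(v : V) degree v.

Definition has_walk (u v : V) (n : nat) : bool :=
  [exists p : n.-tuple V, path e u p && (last u p == v)].

(* The least length of a walk from [u] to [v], meaningful when there is one
   ([gdist_walk], [gdist_le]); a shortest walk has length less than [#|V|],
   which bounds the search. *)
Definition gdist (u v : V) : nat := find (has_walk u v) (iota 0 #|V|).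

Lemma has_walkP u v n :
  reflect (exists p : seq V, [/\ size p = n, path e u p & last u p = v])
          (has_walk u v n).
Proof.
apply: (iffP existsP) => [[p /andP[pp /eqP lp]] | [p [sp pp lp]]].
  by exists p; rewrite size_tuple.
have sp' : size p == n by apply/eqP.
by exists (Tuple sp'); rewrite /= pp lp eqxx.
Qed.

Lemma has_short_walk u v :
  connect e u v -> has (has_walk u v) (iota 0 #|V|).
Proof.
case/connectP=> p pp ->; case: (shortenP pp) => q pq uq _.
apply/hasP; exists (size q); last by apply/has_walkP; exists q.
by rewrite mem_iota /= add0n -[(size q).+1]/(size (u :: q)) -(card_uniqP uq) max_card.
Qed.

Lemma gdist_walk u v : connect e u v -> has_walk u v (gdist u v).
Proof.
move=> /has_short_walk h; have := nth_find 0 h.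
by rewrite nth_iota // -[X in _ < X](size_iota 0) -has_find.
Qed.

Lemma gdist_le u v n : has_walk u v n -> gdist u v <= n.
Proof.
move=> w; rewrite leqNgt; apply/negP => lt.
have := before_find 0 lt; rewrite nth_iota ?w //.
by apply: leq_trans lt _; rewrite -[X in _ <= X](size_iota 0) find_size.
Qed.

Lemma gdist_gt0 u v : u != v -> 0 < gdist u v.
Proof.
move=> uv; rewrite /gdist.
have : 0 < #|V| by apply/card_gt0P; exists u.
case: #|V| => //= n _; case: ifP => // /has_walkP[p [/size0nil -> _ /= E]].
by rewrite E eqxx in uv.
Qed.

(* Vertices in different components are at infinite distance, so there is no
   constraint between them. *)
Definition tone_coloring (t : nat) (C : finType) (f : {ffun V -> {set C}}) : bool :=
  [forall v, #|f v| == t] &&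
  [forall u, forall v, (u != v) ==> connect e u v ==>
     (#|f u :&: f v| < gdist u v)].

Definition tone_colorable (t k : nat) : bool :=
  [exists f : {ffun V -> {set 'I_k}}, tone_coloring t f].

Lemma exists_tone_colorable t : exists k, tone_colorable t k.
Proof.
exists #|{: V * 'I_t}|; apply/existsP.
pose g (v : V) := [set enum_rank (v, i) | i : 'I_t].
exists [ffun v => g v]; apply/andP; split.
  apply/forallP=> v; rewrite ffunE card_imset ?card_ord //.
  by move=> i j /enum_rank_inj[].
apply/forallP=> u; apply/forallP=> v; apply/implyP=> uv; apply/implyP=> _.
rewrite !ffunE; suff -> : g u :&: g v = set0 by rewrite cards0 gdist_gt0.
apply/setP=> x; rewrite !inE; apply/negP=> /andP[/imsetP[i _ ->] /imsetP[j _]].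
by case/enum_rank_inj=> E; rewrite E eqxx in uv.
Qed.

Definition tone_number (t : nat) : nat := ex_minn (exists_tone_colorable t).

End Graph.

(* Main.v *)
Require Import Defs.
From mathcomp Require Import all_boot all_order all_algebra reals.
From mathcomp Require Import all_fingroup zify ring lra.

(** Root the tree and read each vertex through the labels on its path to the root,
    newest label first.  A tree packing assigns [t]-sets of points to such label
    lists so that two different lists agreeing after their first [j] labels get sets
    with fewer than [2j] common points.  It can be blown up: add to each label a
    pair of elements of a ring [R], let the pairs of a list be the coefficients of a
    polynomial [F], and replace each point [p] of a block by [(p, F(x_p))].  Distinct
    polynomials that agree beyond degree [2j] meet in fewer than [2j] points, so the
    points are multiplied by [#|R|] and the labels by [#|R|^2].  Hence one packing
    with [M] points and almost [M^2 / (t(t-1))] labels suffices for all degrees.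

    Such packings come from a density increment.  In a blow-up, permute the points
    independently and at random over each polynomial.  A generic [t]-tuple of points
    meets distinct polynomials in its pairs, quadruples, and so on, so the events
    that these are unused are independent, and a positive proportion of all tuples is
    compatible with the blow-up as long as the packing is not dense.  A maximal
    conflict-free family of compatible tuples raises the density by a constant.

    Vertices of different levels are separated greedily: by linearity only
    [O(#|R|)] of the labels of a vertex can lead to a conflict. *)

Set Implicit Arguments.
Unset Strict Implicit.
Unset Printing Implicit Defensive.
Import GRing.Theory.

(** * Polynomials with paired coefficients *)

Section PairPoly.
Variable R : finComUnitRingType.
Local Open Scope ring_scope.

(** The newest labels sit in the lowest degrees, so lists that agree after their first [b] entries
    have polynomials whose difference has size at most [2 * b]. *)
Fixpoint pairpoly (s : seq (R * R)) : {poly R} :=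
  if s is a :: s' then a.1%:P + a.2%:P * 'X + 'X^2 * pairpoly s' else 0.

Lemma pairpoly_cat s u :
  pairpoly (s ++ u) = pairpoly s + 'X^((size s).*2) * pairpoly u.
Proof.
elim: s => [|a s IH] /=; first by rewrite expr0 mul1r add0r.
by rewrite IH doubleS !exprS expr0; ring.
Qed.

Lemma size_pairpoly s : (size (pairpoly s) <= (size s).*2)%N.
Proof.
elim: s => [|a s IH] /=; first by rewrite size_poly0.
rewrite (leq_trans (size_polyD _ _)) // geq_max; apply/andP; split.
  rewrite (leq_trans (size_polyD _ _)) // geq_max size_polyC.
  apply/andP; split; first by case: (_ != 0); lia.
  by rewrite (leq_trans (size_polyMleq _ _)) // size_polyX size_polyC; case: (_ != 0); lia.
rewrite (leq_trans (size_polyMleq _ _)) // size_polyXn; lia.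
Qed.

Lemma pairpoly_inj s s' :
  size s = size s' -> pairpoly s = pairpoly s' -> s = s'.
Proof.
elim: s s' => [|a s IH] [|b s'] //= [szE] E.
have coefE (c : R * R) p : (forall i, (c.1%:P + c.2%:P * 'X + 'X^2 * p)`_i =
   if i is i'.+1 then if i' is k.+1 then p`_k else c.2 else c.1).
  move=> [|[|i]]; rewrite !coefD !coefC coefMX coefXnM coefC /= ?addr0 //.
    by rewrite add0r.
  by rewrite !add0r subn2.
have Ec i := congr1 (fun p : {poly R} => p`_i) E.
congr (_ :: _).
  have := Ec 0%N; have := Ec 1%N; rewrite /= !coefE.
  by case: (a) (b) => [? ?] [? ?] /= -> ->.
apply: IH => //; apply/polyP => i; have := Ec i.+2; by rewrite /= !coefE.
Qed.

Variables (P : finType) (x : P -> R).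
Hypothesis xunit : forall i j, i != j -> x i - x j \is a GRing.unit.

(** [R] may have zero divisors; unit differences of the points [x i] still bound the number of roots
    among them. *)
Lemma poly_vanish0 (p : {poly R}) (S : {set P}) :
  (forall i, i \in S -> p.[x i] = 0) -> (size p <= #|S|)%N -> p = 0.
Proof.
move=> pS szp; apply/eqP; apply: contraTT szp => pN0; rewrite -ltnNge.
have := @max_ring_poly_roots _ p [seq x i | i <- enum S] pN0.
rewrite size_map -cardE; apply.
  by apply/allP => y /mapP[i]; rewrite mem_enum => iS ->; apply/rootP/pS.
move: (enum_uniq S); move: (enum S) => l {pS pN0}.
elim: l => //= i l IH /andP[il ul]; rewrite IH // andbT.
apply/allP => y /mapP[j jl ->]; rewrite /diff_roots mulrC eqxx /=.
by apply: xunit; apply: contraNneq il => <-.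
Qed.

Definition agree (s s' : seq (R * R)) : {set P} :=
  [set i | (pairpoly s).[x i] == (pairpoly s').[x i]].

(** The difference involves only the first [b] pairs, so it has size at most [2 * b] and vanishes at
    [2 * b] points. *)
Lemma agree_eq b s s' : size s = size s' -> drop b s = drop b s' ->
  (b.*2 <= #|agree s s'|)%N -> s = s'.
Proof.
move=> sz db ag; rewrite -(cat_take_drop b s) -(cat_take_drop b s') db.
congr (_ ++ _); apply: pairpoly_inj; first by rewrite !size_take sz.
apply/eqP; rewrite -subr_eq0; apply/eqP.
apply: (@poly_vanish0 _ (agree s s')).
  move=> i; rewrite inE -{1}(cat_take_drop b s) -{1}(cat_take_drop b s').
  rewrite !pairpoly_cat db !size_take sz !hornerE => /eqP.
  by move/addIr => ->; rewrite subrr.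
apply: leq_trans ag; rewrite (leq_trans (size_polyD _ _)) // geq_max size_polyN.
apply/andP; split; apply: leq_trans (size_pairpoly _) _;
  by rewrite leq_double size_take; case: ltnP.
Qed.

End PairPoly.

(** * Tree packings and their blow-ups *)

Section Lift.
Variables (R : finComUnitRingType) (P : finType) (x : P -> R).

(** Over one polynomial and one permutation, lifted blocks meet as their originals do; over two
    polynomials they meet only where these agree. *)
Definition lift_block (u : {perm P}) (s : seq (R * R)) (T : {set P}) :
    {set P * R} :=
  [set (u p, ((pairpoly s).[x (u p)])%R) | p in T].

Implicit Types (u : {perm P}) (s : seq (R * R)) (T : {set P}).

Lemma lift_inj u s : injective (fun p => (u p, ((pairpoly s).[x (u p)])%R)).
Proof. by move=> p p' [/perm_inj]. Qed.

Lemma card_lift_block u s T : #|lift_block u s T| = #|T|.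
Proof. by rewrite card_imset //; apply: lift_inj. Qed.

Lemma lift_block_inj u s : injective (lift_block u s).
Proof. by apply: imset_inj; apply: lift_inj. Qed.

Lemma lift_blockI u s T T' :
  #|lift_block u s T :&: lift_block u s T'| = #|T :&: T'|.
Proof.
by rewrite -imsetI ?card_imset //; [apply: lift_inj | move=> p p' _ _; apply: lift_inj].
Qed.

Lemma mem_lift_block u s T p :
  p \in lift_block u s T -> p.1 \in u @: T /\ p.2 = ((pairpoly s).[x p.1])%R.
Proof. by case/imsetP => i iT ->; split=> //=; apply: imset_f. Qed.

Lemma lift_block_capE u s T (A : {set P * R}) :
  #|A :&: lift_block u s T| = #|[set p.1 | p in A :&: lift_block u s T]|.
Proof.
rewrite card_in_imset // => -[a b] [a' b'] /setIP[_ /mem_lift_block[_ /= ->]].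
by move=> /setIP[_ /mem_lift_block[_ /= ->]] ->.
Qed.

Lemma lift_block_agree u s T u' s' T' :
  #|lift_block u s T :&: lift_block u' s' T'| <= #|agree x s s'|.
Proof.
rewrite lift_block_capE; apply: subset_leq_card; apply/subsetP => y /imsetP[p].
move=> /setIP[/mem_lift_block[_ E1] /mem_lift_block[_ E2]] ->.
by rewrite inE -E1 -E2.
Qed.

End Lift.

Section TreePacking.
Variables (t H : nat).

(* [k] lists the labels of the proper ancestors of a vertex, nearest first, and
   [A k] the blocks available to that vertex: [drop j k = drop j k'] says that two
   vertices of the same level are at distance at most [2 * j.+1]. *)
Definition tree_packing (C P : finType) (A : H.-tuple C -> {set {set P}}) :=
  (forall k T, T \in A k -> #|T| = t) /\
  (forall k k' T T' j, T \in A k -> T' \in A k' -> (k, T) != (k', T') ->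
     j <= H -> drop j k = drop j k' -> #|T :&: T'| <= j.*2.+1).

(** When [t * (t - 1) * #|C| = #|P| ^ 2], the ratio [total A / #|C| ^ H.+1] is the density of the
    packing, at most 1. *)
Definition total (C P : finType) (A : H.-tuple C -> {set {set P}}) :=
  \sum_(k : H.-tuple C) #|A k|.

Variables (C P : finType) (A : H.-tuple C -> {set {set P}}).
Variables (R : finComUnitRingType) (x : P -> R).
Hypothesis xunit : forall i j, i != j -> (x i - x j)%R \is a GRing.unit.
Hypothesis Apack : tree_packing A.
Hypothesis t_ge2 : 2 <= t.

Definition ctx_labels (k : H.-tuple (C * (R * R))) : H.-tuple C :=
  [tuple of map fst k].
Definition ctx_coefs (k : H.-tuple (C * (R * R))) : H.-tuple (R * R) :=
  [tuple of map snd k].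

(** The pair [y.1] belongs to the vertex itself and precedes those of its ancestors, so a polynomial
    has [H.+1] pairs; each polynomial has its own permutation. *)
Definition blowup (f : {ffun H.+1.-tuple (R * R) -> {perm P}})
    (k : H.-tuple (C * (R * R))) : {set {set P * R}} :=
  [set let s := [tuple of y.1 :: ctx_coefs k] in lift_block x (f s) s y.2
     | y in setX setT (A (ctx_labels k))].

Lemma blowup_lift f k T : T \in blowup f k ->
  exists s : H.+1.-tuple (R * R), exists2 U, U \in A (ctx_labels k) &
   behead s = ctx_coefs k /\ T = lift_block x (f s) s U.
Proof.
case/imsetP => -[l U] /setXP[_ /= UA] ->.
by exists [tuple of l :: ctx_coefs k], U.
Qed.

Lemma ctx_eq (k k' : H.-tuple (C * (R * R))) :
  map fst k = map fst k' -> map snd k = map snd k' -> k = k'.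
Proof.
case: k k' => [k kH] [k' kH'] /= E1 E2; apply: val_inj => /=.
elim: k k' {kH kH'} E1 E2 => [|[a b] k IH] [|[a' b'] k'] //= [-> E1] [-> E2].
by rewrite (IH k').
Qed.

(** Different polynomials are separated by interpolation, with [j.+1] because the own pair comes
    before the context; over the same polynomial the bound is inherited from [A]. *)
Lemma blowup_pack f : tree_packing (blowup f).
Proof.
case: Apack => Acard Aconf; split=> [k T|k k' T T' j].
  by case/blowup_lift => s [U UA [_ ->]]; rewrite card_lift_block; apply: Acard UA.
case/blowup_lift => s [U UA [sE TE]]; case/blowup_lift => s' [U' UA' [sE' TE']].
move=> neq jH dj; rewrite leqNgt; apply/negP => big.
have ss' : s = s'.
  apply: val_inj; apply: (@agree_eq _ _ x xunit j.+1); first by rewrite !size_tuple.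
    rewrite -[j.+1]addn1 -!drop_drop !drop1 sE sE' /=.
    by rewrite -!map_drop dj.
  by rewrite doubleS; apply: leq_trans big _; rewrite TE TE'; apply: lift_block_agree.
subst s'; rewrite TE TE' lift_blockI in big.
have /eqP[EL EU] : (ctx_labels k, U) == (ctx_labels k', U').
  apply: contraTT big => ne; rewrite -leqNgt.
  by apply: (Aconf (ctx_labels k) (ctx_labels k')) => //=; rewrite -!map_drop dj.
by case/eqP: neq; rewrite (ctx_eq EL (etrans (esym sE) sE')) TE TE' EU.
Qed.

(** Lifts that coincide agree at [t >= 2] points, and over one context the polynomials differ at
    most in their first pair. *)
Lemma card_blowup f k : #|blowup f k| = #|R| ^ 2 * #|A (ctx_labels k)|.
Proof.
rewrite card_in_imset; first by rewrite cardsX cardsT card_prod.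
move=> [l U] [l' U'] /setXP[_ /= UA] /setXP[_ /= UA'] E.
set s := [tuple of l :: _] in E; set s' := [tuple of l' :: _] in E.
have ss' : s = s'.
  apply: val_inj; apply: (@agree_eq _ _ x xunit 1); first by rewrite !size_tuple.
    by rewrite /s /s' /= !drop0.
  apply: leq_trans (lift_block_agree x (f s) s U (f s') s' U').
  by rewrite E setIid card_lift_block (Apack.1 _ _ UA').
have [ll'] : s = s' :> seq _ by rewrite ss'.
by move: E; rewrite -ss' -ll' => /lift_block_inj ->.
Qed.

End TreePacking.

(** * Counting lemmas *)

Lemma card_fiber_sum (X Y : finType) (g : X -> Y) (U : {set Y}) :
  #|[set u | g u \in U]| = \sum_(y in U) #|[set u | g u == y]|.
Proof.
rewrite -sum1_card (partition_big g (mem U)) /=; last by move=> i; rewrite inE.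
apply: eq_bigr => y yU; rewrite -sum1_card; apply: eq_bigl => u; rewrite !inE.
by case: eqP => [->|]; rewrite ?yU ?andbF.
Qed.

Lemma card_bigcup_le (I X : finType) (D : {set I}) (F : I -> {set X}) m :
  (forall i, i \in D -> #|F i| <= m) -> #|\bigcup_(i in D) F i| <= #|D| * m.
Proof.
move=> Fm; rewrite -sum_nat_const.
apply: leq_trans (_ : \sum_(i in D) #|F i| <= _); last exact: leq_sum.
elim/big_rec2: _ => [|i n B _ IH]; first by rewrite cards0.
by apply: leq_trans (leq_card_setU _ _) _; rewrite leq_add2l.
Qed.

(** In a maximal conflict-free subset, the conflict neighbourhoods of the elements cover [X]. *)
Lemma exists_independent (Y : finType) (X : {set Y}) (conf : rel Y) D :
  symmetric conf -> {in X, reflexive conf} ->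
  (forall y, y \in X -> #|[set y' in X | conf y y']| <= D) ->
  exists B : {set Y}, [/\ B \subset X,
    {in B &, forall y y', y != y' -> ~~ conf y y'} & #|X| <= #|B| * D].
Proof.
move=> csym crefl cD.
pose ind (B : {set Y}) := (B \subset X) &&
  [forall y in B, forall y' in B, (y != y') ==> ~~ conf y y'].
have ind0 : exists B, ind B.
  exists set0; rewrite /ind sub0set /=; apply/forall_inP => y; by rewrite inE.
have [B /maxsetP[/andP[BX /forall_inP Bind] Bmax]] := ex_maxset ind0.
exists B; split=> //.
  by move=> y y' yB y'B ne; have /forall_inP/(_ y' y'B)/implyP := Bind y yB; apply.
apply: leq_trans (card_bigcup_le (F := fun y => [set y' in X | conf y y']) _).
  apply/subset_leq_card/subsetP => y yX.
  have [yB|yB] := boolP (y \in B).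
    by apply/bigcupP; exists y => //; rewrite inE yX crefl.
  apply/bigcupP; apply/exists_inP; apply: contraNT yB => nex.
  rewrite -(Bmax (y |: B)) ?setU11 ?subsetUr //; apply/andP; split.
    by rewrite subUset sub1set yX.
  have nc z : z \in B -> ~~ conf z y.
    move=> zB; apply: contra nex => cz; apply/exists_inP; exists z => //.
    by rewrite inE yX.
  apply/forall_inP => z /setU1P zB; apply/forall_inP => z' /setU1P z'B.
  apply/implyP => ne; case: zB z'B => [zy|zB] [zy'|z'B].
  - by rewrite zy zy' eqxx in ne.
  - by rewrite zy csym nc.
  - by rewrite zy' nc.
  - by have /forall_inP/(_ z' z'B)/implyP := Bind z zB; apply.
by move=> y yB; apply: cD; apply: (subsetP BX).
Qed.

Lemma exists_perm_imset (P : finType) (Q Q' : {set P}) :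
  #|Q| = #|Q'| -> exists u : {perm P}, u @: Q = Q'.
Proof.
move=> cQ; pose s (B : {set P}) := enum B ++ enum (~: B).
have s_uniq B : uniq (s B).
  rewrite cat_uniq !enum_uniq /= andbT; apply/hasPn => y.
  by rewrite !mem_enum inE.
have s_mem B y : y \in s B by rewrite mem_cat !mem_enum inE orbN.
have s_size B : size (s B) = #|P| by rewrite size_cat -!cardE cardsC.
pose f y := nth y (s Q') (index y (s Q)).
have f_inj : injective f.
  move=> y z; rewrite /f (set_nth_default z) ?s_size -?(s_size Q) ?index_mem //.
  move/eqP; rewrite nth_uniq ?s_size -?(s_size Q) ?index_mem // => /eqP E.
  by rewrite -(nth_index y (s_mem Q y)) E nth_index.
exists (perm f_inj); apply/eqP; rewrite eqEcard card_imset; last exact: perm_inj.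
rewrite cQ leqnn andbT; apply/subsetP => y /imsetP[z zQ ->]; rewrite permE /f.
have zi : index z (s Q) < size (enum Q') .
  by rewrite -cardE -cQ cardE index_cat mem_enum zQ index_mem mem_enum.
by rewrite nth_cat zi -mem_enum mem_nth.
Qed.

(** The preimage of [I] under a uniform permutation is uniform among the sets of its size:
    composition with a permutation carrying one set to another compares their fibres, and the family
    of all such sets gives the fibre size. *)
Lemma card_perm_preimset (P : finType) (I : {set P}) (U : {set {set P}}) :
  (forall Q, Q \in U -> #|Q| = #|I|) ->
  #|[set u : {perm P} | (u @^-1: I) \in U]| * 'C(#|P|, #|I|) = #|U| * #|P|`!.
Proof.
move=> cU; pose w Q := #|[set u : {perm P} | u @^-1: I == Q]|.
have w_le (Q Q' : {set P}) : #|Q| = #|Q'| -> w Q <= w Q'.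
  case/exists_perm_imset => v vQ.
  rewrite /w -(card_imset _ (mulgI (v^-1)%g)); apply: subset_leq_card.
  apply/subsetP => u' /imsetP[u]; rewrite !inE => /eqP uI ->.
  apply/eqP/setP => p; rewrite -vQ -uI !inE permM.
  rewrite -[X in _ = (X \in _)](permKV v) mem_imset ?inE //; exact: perm_inj.
have w_eq (Q Q' : {set P}) : #|Q| = #|Q'| -> w Q = w Q'.
  by move=> e; apply/eqP; rewrite eqn_leq !w_le.
have wU (V : {set {set P}}) : (forall Q, Q \in V -> #|Q| = #|I|) ->
  #|[set u : {perm P} | (u @^-1: I) \in V]| = #|V| * w I.
  move=> cV; rewrite (card_fiber_sum (fun u : {perm P} => u @^-1: I)).
  by rewrite -sum_nat_const; apply: eq_bigr => Q QV; apply: w_eq; apply: cV.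
rewrite wU // -mulnA; congr (_ * _).
have := wU [set Q : {set P} | #|Q| == #|I|].
rewrite card_draws mulnC => <-; last by move=> Q; rewrite inE => /eqP.
have := card_perm [set: P]; rewrite cardsT => <-.
rewrite -[RHS]cardsE; apply: eq_card => u; rewrite !inE.
rewrite on_card_preimset ?eqxx; first by apply/esym/subsetP.
by apply: onW_bij; exists (u^-1)%g => p; rewrite ?permK ?permKV.
Qed.

Lemma leq_expn_ffact M s : M ^ s <= M ^_ s + s ^ 2 * M ^ s.-1.
Proof.
elim: s => [|s IH] //; rewrite ffactnSr expnSr /=.
case: s IH => [|s] IH; first by rewrite !expn0 ffactn0; lia.
have [sM|Ms] := leqP s.+1 M; last first.
  by rewrite [M ^ s.+1]expnSr; have : M * M ^ s <= s.+2 ^ 2 * M ^ s; nia.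
rewrite /= in IH; rewrite expnSr in IH *; move: (M ^ s) (M ^_ s.+1) IH => a b IH.
have : (a * M) * (M - s.+1) <= (b + s.+1 ^ 2 * a) * (M - s.+1) by rewrite leq_mul2r IH orbT.
have [d ->] : exists d, M = d + s.+1 by exists (M - s.+1); lia.
rewrite addnK; nia.
Qed.

(** Each pair of consecutive factors of the falling factorial is at most [t * (t - 1)]; the second
    pair, [(t - 2) * (t - 3)], yields the saving [(t - 2) / t]. *)
Lemma ffact_double_bound t j : 0 < j -> j.*2.+2 <= t ->
  t * t ^_ j.*2.+2 <= (t - 2) * (t * (t - 1)) ^ j.+1.
Proof.
elim: j => // -[|j] IH _ jt.
  rewrite !ffactnSr ffactn0 !expnS expn0.
  have [d ->] : exists d, t = d + 4 by exists (t - 4); lia.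
  have -> : d + 4 - 0 = d + 4 by lia. have -> : d + 4 - 1 = d + 3 by lia.
  have -> : d + 4 - 2 = d + 2 by lia. have -> : d + 4 - 3 = d + 1 by lia.
  nia.
have h : t * t ^_ j.+1.*2.+2 <= (t - 2) * (t * (t - 1)) ^ j.+2 by apply: IH => //; lia.
rewrite [j.+2.*2]doubleS ffactnSr ffactnSr [_ ^ j.+3]expnSr !mulnA.
have h2 : (t - j.+1.*2.+2) * (t - j.+1.*2.+3) <= t * (t - 1) by apply: leq_mul; lia.
by have := leq_mul h h2; rewrite !mulnA.
Qed.

(* The left side bounds [t] times the number of sets of size [2j+2] covered by the
   blocks of [N ^ j] contexts: beyond pairs, the packing constraints are not tight. *)
Lemma covered_bound t N M j : 0 < j -> j.*2.+2 <= t -> t * (t - 1) * N = M ^ 2 ->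
  t ^ 3 <= M -> t * (N ^ j.+1 * 'C(t, j.*2.+2)) <= (t - 1) * 'C(M, j.*2.+2).
Proof.
move=> j0 jt NM tM; set s := j.*2.+2.
have f0 : 0 < s`! * (t * (t - 1)) ^ j.+1.
  by rewrite muln_gt0 fact_gt0 expn_gt0 muln_gt0 /=; apply/orP; left; apply/andP; split; lia.
rewrite -(leq_pmul2r f0).
have -> : t * (N ^ j.+1 * 'C(t, s)) * (s`! * (t * (t - 1)) ^ j.+1) =
  M ^ s * (t * t ^_ s).
  have -> : M ^ s = (t * (t - 1)) ^ j.+1 * N ^ j.+1.
    by rewrite -expnMn NM -expnM; congr (_ ^ _); rewrite /s; lia.
  by rewrite -bin_ffact; ring.
have -> : (t - 1) * 'C(M, s) * (s`! * (t * (t - 1)) ^ j.+1) =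
  (t - 1) * M ^_ s * (t * (t - 1)) ^ j.+1 by rewrite -bin_ffact; ring.
apply: leq_trans (leq_mul (leqnn _) (ffact_double_bound j0 jt)) _.
rewrite mulnA leq_mul2r; apply/orP; right.
have h := leq_expn_ffact M s.
(* Replacing [M ^ s] by [M ^_ s] loses at most [M ^ s / (t - 1)], which is the gap between the
   factors [t - 2] and [t - 1]. *)
have h2 : (t - 1) * (s ^ 2 * M ^ s.-1) <= M ^ s.
  rewrite /s /= [M ^ _.+2]expnS mulnA leq_mul2r; apply/orP; right.
  by apply: leq_trans tM; rewrite [t ^ 3]expnS leq_mul ?leq_sqr ?leq_subr.
have : (t - 1) * M ^ s <= (t - 1) * (M ^_ s + s ^ 2 * M ^ s.-1) by rewrite leq_mul2l h orbT.
move: h2; move: (M ^ s) (M ^_ s) (s ^ 2 * M ^ s.-1) => a b c.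
have [d ->] : exists d, t = d.+2 by exists (t - 2); lia.
by rewrite !subn1 subn2 /= mulnDr; lia.
Qed.

Lemma card_tuple_drop (C : finType) H j (u : seq C) : j <= H ->
  #|[set k : H.-tuple C | drop j k == u]| <= #|C| ^ j.
Proof.
move=> jH; rewrite -card_tuple.
pose g (k : H.-tuple C) : j.-tuple C := [tuple tnth k (widen_ord jH i) | i < j].
apply: (@leq_card_in _ _ g) => k k'; rewrite !inE => /eqP dk /eqP dk' E.
apply: val_inj; rewrite /= -(cat_take_drop j k) -(cat_take_drop j k') dk dk'.
congr (_ ++ _); case: (posnP j) => [->|j0]; first by rewrite !take0.
have [c _] : exists c : C, true by exists (tnth k (widen_ord jH (Ordinal j0))).
apply: (@eq_from_nth _ c); first by rewrite !size_take !size_tuple.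
move=> i; rewrite size_take size_tuple => ij.
have ij' : i < j by case: (ltnP j H) ij => // Hj iH; apply: leq_trans iH Hj.
rewrite !nth_take //; have := congr1 (fun w => tnth w (Ordinal ij')) E.
by rewrite !tnth_mktuple !(tnth_nth c).
Qed.

(** * Upper bounds on the size of a packing *)

Section Size.
Variables (t H : nat) (C P : finType) (A : H.-tuple C -> {set {set P}}).
Hypothesis Apack : tree_packing t A.

(** Blocks over one context share at most one point, the case [j = 0], so their families of pairs
    are disjoint. *)
Lemma card_pack_le k : #|A k| * 'C(t, 2) <= 'C(#|P|, 2).
Proof.
pose sub2 (T : {set P}) := [set Q : {set P} | Q \subset T & #|Q| == 2].
have -> : #|A k| * 'C(t, 2) = \sum_(T in A k) #|sub2 T|.
  rewrite -sum_nat_const; apply: eq_bigr => T TA.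
  by rewrite cards_draws (Apack.1 _ _ TA).
have disj T T' : T \in A k -> T' \in A k -> T != T' -> [disjoint sub2 T & sub2 T'].
  move=> TA TA' ne; rewrite -setI_eq0; apply/eqP/setP => Q; rewrite !inE.
  apply/negP => /andP[/andP[QT /eqP Q2] /andP[QT' _]].
  have : #|T :&: T'| <= 1.
    by apply: (Apack.2 k k T T' 0) => //; rewrite xpair_eqE eqxx.
  by rewrite leqNgt -Q2 subset_leq_card // subsetI QT.
rewrite -card_draws.
apply: leq_trans (_ : #|\bigcup_(T in A k) sub2 T| <= _); last first.
  apply: subset_leq_card; apply/subsetP => Q /bigcupP[T _].
  by rewrite !inE => /andP[].
move: disj; rewrite -!big_enum /=; have := enum_uniq (A k).
have: {subset enum (A k) <= A k} by move=> T; rewrite mem_enum.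
elim: (enum (A k)) => [|T l IH] sl /=; first by rewrite !big_nil.
case/andP=> Tl ul disj; rewrite !big_cons cardsU.
suff -> : sub2 T :&: \bigcup_(T' <- l) sub2 T' = set0.
  by rewrite cards0 subn0 leq_add2l; apply: IH => // T' T'l; apply: sl; rewrite inE T'l orbT.
apply/eqP; rewrite setI_eq0 bigcup_seq; apply/bigcup_disjointP => T' T'l.
apply: disj; try (by apply: sl; rewrite inE ?eqxx // T'l orbT).
by apply: contraNneq Tl => ->.
Qed.

Lemma card_pack_leN N k : 2 <= t -> t * (t - 1) * N = #|P| ^ 2 -> #|A k| <= N.
Proof.
move=> t2 NM; have := card_pack_le k; rewrite !bin2 => h.
have h2 : #|A k| * (t * t.-1) <= #|P| * #|P|.-1.
  have d n : n * n.-1 = (n * n.-1)./2.*2.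
    by rewrite -[LHS]odd_double_half oddM; case: n => //= n; rewrite andNb.
  by rewrite (d t) (d #|P|) -doubleMr leq_double.
have t0 : 0 < t * (t - 1) by rewrite muln_gt0; lia.
rewrite -(leq_pmul2r t0); rewrite -subn1 in h2; apply: leq_trans h2 _.
rewrite [N * _]mulnC NM expnS leq_mul2l expn1; apply/orP; right; lia.
Qed.

Lemma total_le N : 2 <= t -> t * (t - 1) * N = #|P| ^ 2 -> #|C| = N ->
  total A <= N ^ H.+1.
Proof.
move=> t2 NM cC; rewrite expnSr -{1}cC -card_tuple.
rewrite -sum_nat_const; apply: leq_sum => k _; exact: (card_pack_leN k t2 NM).
Qed.

End Size.

(** * The improvement step *)

Lemma card_ffun_forall (X Y : finType) (F : X -> {set Y}) :
  #|[set f : {ffun X -> Y} | [forall i, f i \in F i]]| = \prod_i #|F i|.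
Proof.
transitivity (foldr muln 1 [seq #|F i| | i : X]); last first.
  by rewrite foldrE big_map big_enum.
rewrite -card_family cardsE; apply: eq_card => f; rewrite !inE.
by apply/forallP/familyP.
Qed.

Lemma card_ffun_at (n : nat) (Y : finType) (i : 'I_n) (V : {set Y}) :
  #|[set z : {ffun 'I_n -> Y} | z i \in V]| = #|V| * #|Y| ^ n.-1.
Proof.
have -> : [set z : {ffun 'I_n -> Y} | z i \in V] =
  [set z : {ffun 'I_n -> Y} | [forall a, z a \in if a == i then V else setT]].
  apply/setP => z; rewrite !inE; apply/idP/forallP => [zi a|/(_ i)].
    by case: eqP => [->|].
  by rewrite eqxx.
rewrite card_ffun_forall (bigD1 i) //= eqxx; congr (_ * _).
rewrite (eq_bigr (fun=> #|Y|)) => [|a /negPf->]; last by rewrite cardsT.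
by rewrite prod_nat_const; congr (_ ^ _); rewrite cardC1 card_ord.
Qed.

Lemma sum_card_exchange (X Y : finType) (D : {set Y}) (r : X -> Y -> bool) :
  \sum_x #|[set y in D | r x y]| = \sum_(y in D) #|[set x | r x y]|.
Proof.
rewrite (eq_bigr (fun x => \sum_(y in D) if r x y then 1 else 0)); last first.
  move=> x _; rewrite -sum1_card -big_mkcondr /=.
  by apply: eq_bigl => y; rewrite inE.
rewrite exchange_big; apply: eq_bigr => y _.
by rewrite -sum1_card -big_mkcond; apply: eq_bigl => x; rewrite inE.
Qed.

Lemma card_perm_type (P : finType) : #|{perm P}| = #|P|`!.
Proof.
have := card_perm [set: P]; rewrite cardsT => <-.
by apply: eq_card => u; apply/esym/subsetP.
Qed.

Section SumCtx.
Variables (H : nat) (C L : finType).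

Lemma sum_tuple_fst (F : H.-tuple C -> nat) :
  \sum_(k : H.-tuple (C * L)) F [tuple of map fst k] =
  #|L| ^ H * \sum_(c : H.-tuple C) F c.
Proof.
pose h (y : H.-tuple C * H.-tuple L) : H.-tuple (C * L) := [tuple of zip y.1 y.2].
pose h' (k : H.-tuple (C * L)) := ([tuple of map fst k], [tuple of map snd k]).
have hK : cancel h h'.
  move=> [c m]; congr (_, _); apply: val_inj => /=.
    by rewrite -/(unzip1 _) unzip1_zip // !size_tuple.
  by rewrite -/(unzip2 _) unzip2_zip // !size_tuple.
have h'K : cancel h' h.
  by move=> k; apply: val_inj; rewrite /= -/(unzip1 _) -/(unzip2 _) zip_unzip.
rewrite (reindex h); last by exists h' => y _.
rewrite (eq_bigr (fun y => F y.1)); last first.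
  by move=> y _; congr F; have := congr1 fst (hK y).
rewrite -(pair_bigA _ (fun c (m : H.-tuple L) => F c)) /= big_distrr /=.
by apply: eq_bigr => c _; rewrite sum_nat_const card_tuple.
Qed.

End SumCtx.

Section Improve.
Variables (t H E : nat) (C P : finType) (A : H.-tuple C -> {set {set P}}).
Variables (R : finComUnitRingType) (x : P -> R).
Hypothesis xunit : forall i j, i != j -> (x i - x j)%R \is a GRing.unit.
Hypothesis Apack : tree_packing t A.
Hypothesis t_ge2 : 2 <= t.
Hypothesis E_gt0 : 0 < E.
Hypothesis NM : t * (t - 1) * #|C| = #|P| ^ 2.
Hypothesis M_ge_t : 4 * t ^ 3 <= #|P|.
Hypothesis M_ge_E : 4 * E <= #|P|.
Hypothesis q_ge : 2 ^ t.+2 <= #|R|.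

Notation K := (4 * E * t).
Implicit Types (z : {ffun 'I_t -> P * R}) (c : H.-tuple C) (j : nat).
Implicit Types (s : H.+1.-tuple (R * R)) (mu : H.-tuple (R * R)).

(** Subtraction-free form of [#|A c| <= (1 - 1 / (2 * E)) * #|C|]. *)
Definition deficient c := 2 * E * #|A c| + #|C| <= 2 * E * #|C|.

(** The obstructions for a new block over [c]: its points on one polynomial, pulled back by the
    permutation, must not form such a set. *)
Definition covered j c : {set {set P}} :=
  [set Q : {set P} | (#|Q| == j.*2.+2) &&
    [exists c2 : H.-tuple C, (drop j c2 == drop j c) &&
      [exists T in A c2, Q \subset T]]].

Lemma card_covered j c m : j <= H ->
  (forall c2 : H.-tuple C, drop j c2 = drop j c -> #|A c2| <= m) ->
  #|covered j c| <= #|C| ^ j * (m * 'C(t, j.*2.+2)).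
Proof.
move=> jH Am; pose D := [set c2 : H.-tuple C | drop j c2 == drop j c].
pose sub (T : {set P}) := [set Q : {set P} | Q \subset T & #|Q| == j.*2.+2].
apply: leq_trans (_ : #|\bigcup_(c2 in D) \bigcup_(T in A c2) sub T| <= _).
  apply/subset_leq_card/subsetP => Q; rewrite inE => /andP[cQ].
  case/existsP => c2 /andP[dc /exists_inP[T TA QT]].
  apply/bigcupP; exists c2; first by rewrite inE.
  by apply/bigcupP; exists T => //; rewrite inE QT.
apply: leq_trans (card_bigcup_le (m := m * 'C(t, j.*2.+2)) _) _.
  move=> c2; rewrite inE => /eqP dc.
  apply: leq_trans (card_bigcup_le (m := 'C(t, j.*2.+2)) _) _.
    by move=> T TA; rewrite cards_draws (Apack.1 _ _ TA).
  by rewrite leq_mul2r Am ?orbT.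
by rewrite leq_mul2r card_tuple_drop ?orbT.
Qed.

(** For pairs the room comes from the deficiency of [c]; for larger sets [covered_bound] leaves at
    least a proportion [1 / t] free. *)
Lemma covered_free j c : deficient c -> j <= H -> j.*2.+2 <= t ->
  'C(#|P|, j.*2.+2) <= K * ('C(#|P|, j.*2.+2) - #|covered j c|).
Proof.
rewrite /deficient => cdef jH jt; case: (posnP j) => [j0|j0].
  have binM2 n : 'C(n, 2) * 2 = n * (n - 1).
    by rewrite -[X in _ * X]/(2`!) bin_ffact !ffactnS ffactn0 muln1 subn1.
  subst j; have h : #|covered 0 c| <= #|A c| * 'C(t, 2).
    rewrite -[X in _ <= X]mul1n -(expn0 #|C|).
    by apply: card_covered => // c2; rewrite !drop0 => /val_inj ->.
  have h1 : #|covered 0 c| * 2 <= #|A c| * (t * (t - 1)).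
    by rewrite -binM2 mulnA leq_mul2r h.
  have h2 : 'C(#|P|, 2) * 2 + #|P| = #|P| ^ 2.
    by rewrite binM2; case: #|P| => // n; rewrite expnS; lia.
  rewrite /=; move: (#|covered 0 c|) ('C(#|P|, 2)) h1 h2 => w b h1 h2.
  have h3 : 2 * E * (w * 2) + #|P| ^ 2 <= 2 * E * #|P| ^ 2.
    rewrite -NM; have : 2 * E * (w * 2) <= 2 * E * (#|A c| * (t * (t - 1))).
      by rewrite leq_mul2l h1 orbT.
    have : (t * (t - 1)) * (2 * E * #|A c| + #|C|) <= (t * (t - 1)) * (2 * E * #|C|).
      by rewrite leq_mul2l cdef orbT.
    lia.
  (* Passing from [#|P| ^ 2] to [#|P| * (#|P| - 1)] costs at most half of the slack in [h3]. *)
  have h4 : 4 * E * #|P| <= #|P| ^ 2 by rewrite expnS expn1 leq_mul2r M_ge_E orbT.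
  have h5 : b <= 4 * E * (b - w).
    have h6 : 2 * E * (b * 2 + #|P|) = 2 * E * #|P| ^ 2 by rewrite h2.
    rewrite mulnBr; lia.
  by rewrite mulnAC; apply: leq_trans h5 _; rewrite leq_pmulr //; lia.
have h : #|covered j c| <= #|C| ^ j.+1 * 'C(t, j.*2.+2).
  rewrite expnSr -mulnA; apply: card_covered => // c2 _.
  exact: (card_pack_leN Apack c2 t_ge2 NM).
have h2 : t * (#|C| ^ j.+1 * 'C(t, j.*2.+2)) <= (t - 1) * 'C(#|P|, j.*2.+2).
  by apply: covered_bound => //; lia.
move: h h2; move: (_ ^ _ * _) (#|covered _ _|) ('C(#|P|, _)) => a w b h h2.
have h3 : t * w <= (t - 1) * b by apply: leq_trans h2; rewrite leq_mul2l h orbT.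
have h4 : b <= t * (b - w).
  by rewrite mulnBr; rewrite mulnBl mul1n in h3; have : b <= t * b; [rewrite leq_pmull | ]; lia.
by rewrite -mulnA; apply: leq_trans h4 _; rewrite leq_pmull //; lia.
Qed.

Definition zset z : {set P * R} := [set z i | i : 'I_t].

Definition onpoly z (s : seq (R * R)) : {set 'I_t} :=
  [set i | ((pairpoly s).[x (z i).1])%R == (z i).2].

Definition groups z (s : seq (R * R)) : {set P} := [set (z i).1 | i in onpoly z s].

(* A generic tuple meets no polynomial in more points than interpolation forces. *)
Definition generic mu z : bool :=
  injectiveb (fun i => (z i).1) &&
  [forall j : 'I_H.+1, forall s : H.+1.-tuple (R * R),
     (drop j.+1 s == drop j mu) ==> (#|onpoly z s| <= j.*2.+2)].

Lemma card_groups mu z s : generic mu z -> #|groups z s| = #|onpoly z s|.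
Proof.
by case/andP => /injectiveP zinj _; rewrite card_in_imset // => i i' _ _; apply: zinj.
Qed.

Lemma generic_onpoly mu z j s : generic mu z -> j <= H ->
  drop j.+1 s = drop j mu -> #|onpoly z s| <= j.*2.+2.
Proof.
case/andP => _ /forallP g jH ds.
have /forallP/(_ s)/implyP := g (Ordinal (n := H.+1) jH).
by rewrite /= ds eqxx; apply.
Qed.

(** Compatibility of [z] over the context [(c, mu)] is reduced to a separate condition on the
    permutation of each polynomial [s]. *)
Definition goodperm c mu z s : {set {perm P}} :=
  [set u : {perm P} | [forall j : 'I_H.+1, (drop j.+1 s == drop j mu) ==>
    [forall c2 : H.-tuple C, (drop j c2 == drop j c) ==>
      [forall T in A c2, #|groups z s :&: u @: T| <= j.*2.+1]]]].

(* Only special polynomials constrain their permutation; a generic tuple has at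
   most one special polynomial for each subset of its coordinates. *)
Definition special mu z s : bool :=
  [exists j : 'I_H.+1, (drop j.+1 s == drop j mu) && (#|onpoly z s| == j.*2.+2)].

Lemma goodperm_full c mu z s : generic mu z -> ~~ special mu z s ->
  goodperm c mu z s = setT.
Proof.
move=> zg /existsPn ns; apply/setP => u; rewrite !inE; apply/forallP => j.
apply/implyP => /eqP ds; apply/forallP => c2; apply/implyP => _.
apply/forall_inP => T _; apply: leq_trans (subset_leq_card (subsetIl _ _)) _.
have jH : j <= H by rewrite -ltnS.
rewrite (card_groups _ zg); have := generic_onpoly zg jH ds.
by have := ns j; rewrite ds eqxx /=; lia.
Qed.

(** For special [s], a conflict puts all points of [z] on [s] into one permuted block, so [u] pulls
    them back to a covered set. The pulled-back set is uniform, and a proportion at least [1 / K] of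
    the sets is uncovered. *)
Lemma card_goodperm c mu z s : deficient c -> generic mu z ->
  #|P|`! <= K * #|goodperm c mu z s|.
Proof.
move=> cdef zg.
have [/existsP[j0 /andP[/eqP ds0 /eqP cz]]|ns] := boolP (special mu z s); last first.
  rewrite goodperm_full // cardsT card_perm_type.
  by rewrite leq_pmull // !muln_gt0 E_gt0; lia.
have jH : j0 <= H by rewrite -ltnS.
have jt : j0.*2.+2 <= t by rewrite -cz -[X in _ <= X]card_ord max_card.
set I := groups z s; have cI : #|I| = j0.*2.+2 by rewrite (card_groups _ zg).
have sub : ~: [set u : {perm P} | u @^-1: I \in covered j0 c] \subset goodperm c mu z s.
  apply/subsetP => u; rewrite in_setC inE => uI; rewrite inE; apply/forallP => j.
  apply/implyP => /eqP ds; apply/forallP => c2; apply/implyP => dc.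
  apply/forall_inP => T TA; rewrite leqNgt; apply: contra uI => big.
  have jH' : j <= H by rewrite -ltnS.
  have le1 := generic_onpoly zg jH' ds; rewrite cz in le1.
  have le2 := leq_trans big (subset_leq_card (subsetIl _ _)).
  (* Genericity bounds the group by [j.*2.+2] points and a conflict needs that many, so only the
     level [j0] matters. *)
  have jj : val j = j0 by move: le1 le2; rewrite -/I cI /=; lia.
  have IT : I \subset u @: T.
    apply/setIidPl/eqP; rewrite eqEcard subsetIl /= cI -jj.
    by apply: leq_trans big.
  rewrite inE; apply/andP; split.
    rewrite on_card_preimset ?cI //.
    by apply: onW_bij; exists (u^-1)%g => p; rewrite ?permK ?permKV.
  apply/existsP; exists c2; rewrite -jj dc /=; apply/exists_inP; exists T => //.
  apply/subsetP => p; rewrite inE => /(subsetP IT); rewrite mem_imset //; exact: perm_inj.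
have := card_perm_preimset (P := P) (I := I) (U := covered j0 c).
have cU Q : Q \in covered j0 c -> #|Q| = #|I|.
  by rewrite inE cI => /andP[/eqP].
move=> /(_ cU); rewrite cI => cc.
have free := covered_free cdef jH jt.
have b0 : 0 < 'C(#|P|, j0.*2.+2).
  by rewrite bin_gt0; apply: leq_trans jt _; apply: leq_trans M_ge_t; rewrite !expnS; nia.
rewrite -(leq_pmul2r b0).
apply: leq_trans (_ : K * #|~: [set u : {perm P} | u @^-1: I \in covered j0 c]| *
    'C(#|P|, j0.*2.+2) <= _); last first.
  by rewrite leq_mul2r leq_mul2l (subset_leq_card sub) !orbT.
rewrite cardsCs setCK card_perm_type -mulnA mulnBl cc [_`! * _]mulnC -mulnBl mulnA.
by rewrite leq_mul2r free orbT.
Qed.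

(** The coordinates on [s] determine it: their number gives [j], the tail comes from [mu], and
    [j.*2.+2] values fix the remaining pairs. *)
Lemma card_special mu z : generic mu z -> #|[set s | special mu z s]| <= 2 ^ t.
Proof.
move=> zg; have -> : 2 ^ t = #|{set 'I_t}|.
  by rewrite -cardsT -powersetT card_powerset cardsT card_ord.
apply: (@leq_card_in _ _ (fun s : H.+1.-tuple (R * R) => onpoly z s)) => s s'.
rewrite !inE => /existsP[j /andP[/eqP ds /eqP cs]] /existsP[j' /andP[/eqP ds' /eqP cs']] eqo.
have jj : val j = val j' by move: cs; rewrite eqo cs' /=; lia.
apply: val_inj; apply: (@agree_eq _ _ x xunit j.+1); first by rewrite !size_tuple.
  by rewrite ds jj ds'.
rewrite doubleS -cs -(card_groups _ zg); apply: subset_leq_card.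
apply/subsetP => p /imsetP[i io ->]; have := io; rewrite eqo !inE.
by move: io; rewrite inE => /eqP -> /eqP ->.
Qed.

Definition compat (f : {ffun H.+1.-tuple (R * R) -> {perm P}})
    (k : H.-tuple (C * (R * R))) z : bool :=
  [forall j : 'I_H.+1, forall k2 : H.-tuple (C * (R * R)),
    (drop j k2 == drop j k) ==>
      [forall T in blowup A x f k2, #|zset z :&: T| <= j.*2.+1]].

Lemma compat_goodperm (f : {ffun H.+1.-tuple (R * R) -> {perm P}}) k z :
  (forall s, f s \in goodperm (ctx_labels k) (ctx_coefs k) z s) -> compat f k z.
Proof.
move=> fg; apply/forallP => j; apply/forallP => k2; apply/implyP => /eqP dk.
apply/forall_inP => T /blowup_lift[s [U UA [sE ->]]].
have := fg s; rewrite inE => /forallP/(_ j)/implyP.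
have -> : drop j.+1 s = drop j (ctx_coefs k).
  by rewrite -[j.+1]addn1 -drop_drop drop1 sE /= -!map_drop dk.
rewrite eqxx => /(_ isT)/forallP/(_ (ctx_labels k2))/implyP.
rewrite /= -!map_drop dk eqxx => /(_ isT)/forall_inP/(_ U UA).
apply: leq_trans; rewrite lift_block_capE; apply: subset_leq_card.
apply/subsetP => p /imsetP[w /setIP[/imsetP[i _ wE] /mem_lift_block[w1 w2]] ->].
rewrite inE w1 andbT; apply/imsetP; exists i; last by rewrite wE.
by rewrite inE -wE w2.
Qed.

(** The permutations are chosen independently, and only the special polynomials, at most [2 ^ t] of
    them, cost a factor [K], whatever the size of [R]. *)
Lemma card_compat k z : deficient (ctx_labels k) -> generic (ctx_coefs k) z ->
  #|{ffun H.+1.-tuple (R * R) -> {perm P}}| <=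
    K ^ (2 ^ t) * #|[set f | compat f k z]|.
Proof.
move=> kdef zg; set mu := ctx_coefs k; set c := ctx_labels k.
have K0 : 0 < K by rewrite !muln_gt0 E_gt0; lia.
apply: leq_trans (_ : K ^ (2 ^ t) * \prod_s #|goodperm c mu z s| <= _); last first.
  rewrite leq_mul2l -card_ffun_forall; apply/orP; right; apply: subset_leq_card.
  by apply/subsetP => f; rewrite !inE => /forallP; apply: compat_goodperm.
apply: leq_trans (_ : K ^ #|[set s | special mu z s]| *
    \prod_s #|goodperm c mu z s| <= _); last first.
  by rewrite leq_mul2r leq_pexp2l ?orbT // card_special.
rewrite -prod_nat_const big_mkcond -big_split /= card_ffun card_perm_type -prod_nat_const.
apply: leq_prod => s _; rewrite inE.
case: ifPn => ns; first exact: card_goodperm.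
by rewrite mul1n goodperm_full // cardsT card_perm_type.
Qed.

(** * Counting generic tuples *)

Notation kk := (#|P| * #|R|).

(** The first component at [a] is recovered from [b], so it may be overwritten by a default. *)
Lemma card_same_group (a b : 'I_t) : a != b ->
  #|[set z : {ffun 'I_t -> P * R} | (z a).1 == (z b).1]| <= #|R| * kk ^ t.-1.
Proof.
move=> ab; have P0 : 0 < #|P| by apply: leq_trans M_ge_E; lia.
have [p0 _] := card_gt0P P0.
pose g z : {ffun 'I_t -> P * R} := [ffun i => if i == a then (p0, (z a).2) else z i].
have ginj : {in [set z : {ffun 'I_t -> P * R} | (z a).1 == (z b).1] &, injective g}.
  move=> z z'; rewrite !inE => /eqP zz /eqP zz' /ffunP gE; apply/ffunP => i.
  have gi l : l != a -> z l = z' l by move=> /negPf la; have := gE l; rewrite !ffunE la.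
  have [->|ia] := eqVneq i a; last exact: gi.
  have := gE a; rewrite !ffunE eqxx => -[z2].
  by rewrite [z a]surjective_pairing [z' a]surjective_pairing z2 zz zz' gi // eq_sym.
rewrite -(card_in_imset ginj).
apply: leq_trans (_ : #|[set z : {ffun 'I_t -> P * R} | z a \in setX [set p0] setT]| <= _).
  apply/subset_leq_card/subsetP => w /imsetP[z _ ->].
  by rewrite inE ffunE eqxx !inE /= eqxx.
by rewrite card_ffun_at cardsX cards1 mul1n cardsT card_prod.
Qed.

(** The coordinates other than [i0] are enough to interpolate the polynomial, so the second
    component at [i0] is redundant and is overwritten by 0. *)
Lemma card_overfull mu (S : {set 'I_t}) :
  #|[set z : {ffun 'I_t -> P * R} | injectiveb (fun i => (z i).1) && [exists j : 'I_H.+1,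
      exists s : H.+1.-tuple (R * R),
      [&& drop j.+1 s == drop j mu, j.*2.+2 < #|S| & S \subset onpoly z s]]]|
   <= #|P| * kk ^ t.-1.
Proof.
set B := [set z : {ffun 'I_t -> P * R} | _].
have [S0|[i0 i0S]] := set_0Vmem S.
  rewrite [B](_ : _ = set0) ?cards0 //.
  apply/setP => z; rewrite !inE; apply/negP => /andP[_ /existsP[j /existsP[s]]].
  by rewrite S0 cards0 andbF.
pose g z : {ffun 'I_t -> P * R} :=
  [ffun i => if i == i0 then ((z i0).1, 0%R) else z i].
have ginj : {in B &, injective g}.
  move=> z z'; rewrite !inE.
  move=> /andP[/injectiveP zinj /existsP[j /existsP[s /and3P[/eqP ds jS So]]]].
  move=> /andP[_ /existsP[j' /existsP[s' /and3P[/eqP ds' jS' So']]]] /ffunP gE.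
  have gi l : l != i0 -> z l = z' l by move=> /negPf la; have := gE l; rewrite !ffunE la.
  have z1 : (z i0).1 = (z' i0).1 by have := gE i0; rewrite !ffunE eqxx => -[].
  have zo i : i \in S -> (z i).2 = ((pairpoly s).[x (z i).1])%R.
    by move=> /(subsetP So); rewrite inE => /eqP.
  have zo' i : i \in S -> (z' i).2 = ((pairpoly s').[x (z' i).1])%R.
    by move=> /(subsetP So'); rewrite inE => /eqP.
  (* The two tuples may be overfull at different levels; the larger level serves for both, since the
     tail conditions pass upwards. *)
  have dmax (l : nat) (w : H.+1.-tuple (R * R)) : drop l.+1 w = drop l mu ->
      l <= maxn j j' -> drop (maxn j j').+1 w = drop (maxn j j') mu.
    move=> dw lm; rewrite -(subnK lm) -addnS -!drop_drop dw //.
  have ss : s = s'.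
    apply: val_inj; apply: (@agree_eq _ _ x xunit (maxn j j').+1).
    - by rewrite !size_tuple.
    - by rewrite (dmax _ _ ds) ?leq_maxl // (dmax _ _ ds') ?leq_maxr.
    - have : (maxn j j').*2.+2 < #|S| by rewrite /maxn; case: ifP.
      rewrite (cardsD1 i0) i0S add1n ltnS doubleS => /leq_trans; apply.
      rewrite -(card_imset (S :\ i0) zinj); apply: subset_leq_card.
      apply/subsetP => p /imsetP[i /setD1P[ii0 iS] ->]; rewrite inE.
      by rewrite -zo // gi // -zo'.
  apply/ffunP => i; have [->|ia] := eqVneq i i0; last exact: gi.
  rewrite [z i0]surjective_pairing [z' i0]surjective_pairing zo // zo' //.
  by rewrite z1 ss.
rewrite -(card_in_imset ginj).
apply: leq_trans (_ : #|[set z : {ffun 'I_t -> P * R} | z i0 \in setX setT [set 0%R]]| <= _).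
  apply/subset_leq_card/subsetP => w /imsetP[z _ ->].
  by rewrite inE ffunE eqxx !inE /= eqxx.
by rewrite card_ffun_at cardsX cards1 muln1 cardsT card_prod.
Qed.

(** Repeated first components and overfull sets of coordinates each spoil at most a quarter of the
    tuples, by [M_ge_t] and [q_ge]. *)
Lemma card_generic mu : kk ^ t <= 2 * #|[set z : {ffun 'I_t -> P * R} | generic mu z]|.
Proof.
pose B1 := \bigcup_(y in [set y : 'I_t * 'I_t | y.1 != y.2])
   [set z : {ffun 'I_t -> P * R} | (z y.1).1 == (z y.2).1].
pose B2 := \bigcup_(S in [set: {set 'I_t}])
  [set z : {ffun 'I_t -> P * R} | injectiveb (fun i => (z i).1) && [exists j : 'I_H.+1,
      exists s : H.+1.-tuple (R * R),
      [&& drop j.+1 s == drop j mu, j.*2.+2 < #|S| & S \subset onpoly z s]]].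
have sub : ~: [set z : {ffun 'I_t -> P * R} | generic mu z] \subset B1 :|: B2.
  apply/subsetP => z; rewrite !inE /generic.
  have [zi|/injectivePn[a [b ab zab]] _] := boolP (injectiveb _); last first.
    by apply/orP; left; apply/bigcupP; exists (a, b); rewrite !inE /= ?zab.
  rewrite /= => /forallPn[j /forallPn[s]]; rewrite negb_imply -ltnNge => /andP[ds jz].
  apply/orP; right; apply/bigcupP; exists (onpoly z s); rewrite !inE // zi /=.
  by apply/existsP; exists j; apply/existsP; exists s; rewrite ds jz subxx.
have cB1 : #|B1| <= t ^ 2 * (#|R| * kk ^ t.-1).
  apply: leq_trans (card_bigcup_le (m := #|R| * kk ^ t.-1) _) _.
    by move=> y; rewrite inE; apply: card_same_group.
  rewrite leq_mul2r; apply/orP; right; apply: leq_trans (max_card _) _.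
  by rewrite card_prod card_ord.
have cB2 : #|B2| <= 2 ^ t * (#|P| * kk ^ t.-1).
  apply: leq_trans (card_bigcup_le (m := #|P| * kk ^ t.-1) _) _.
    by move=> S _; apply: card_overfull.
  by rewrite -powersetT card_powerset cardsT card_ord.
have cT : #|{ffun 'I_t -> P * R}| = kk * kk ^ t.-1.
  by rewrite card_ffun card_prod card_ord -expnS prednK //; lia.
have tot := cardsC [set z : {ffun 'I_t -> P * R} | generic mu z]; rewrite cT in tot.
have := leq_trans (subset_leq_card sub) (leq_trans (leq_card_setU _ _) (leq_add cB1 cB2)).
have -> : kk ^ t = kk * kk ^ t.-1 by rewrite -expnS prednK //; lia.
move: tot; move: (kk ^ t.-1) (#|[set z : {ffun 'I_t -> P * R} | _]|) (#|~: _|) => w g n tot h.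
have e1 : 4 * (t ^ 2 * (#|R| * w)) <= kk * w.
  rewrite !mulnA leq_mul2r leq_mul2r; apply/orP; right; apply/orP; right.
  by apply: leq_trans M_ge_t; rewrite -mulnA leq_mul2l -[t * t]/(t ^ 2) leq_exp2l.
have e2 : 4 * (2 ^ t * (#|P| * w)) <= kk * w.
  rewrite [#|P| * #|R|]mulnC !mulnA leq_mul2r leq_mul2r; apply/orP; right; apply/orP; right.
  by apply: leq_trans q_ge; rewrite !expnS mulnA.
lia.
Qed.

(** * Candidate blocks and their conflicts *)

Notation ctx := (H.-tuple (C * (R * R))).
Notation cand := (ctx * {ffun 'I_t -> P * R})%type.

Definition conflict : rel cand := fun y y' =>
  [exists j : 'I_H.+1, (drop j y.1 == drop j y'.1) &&
     (j.*2.+2 <= #|zset y.2 :&: zset y'.2|)].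

Lemma conflict_sym : symmetric conflict.
Proof.
by move=> y y'; apply/eq_existsb => j; rewrite eq_sym setIC.
Qed.

Lemma card_zset z : injective (fun i => (z i).1) -> #|zset z| = t.
Proof.
move=> zi; rewrite card_imset ?card_ord // => i i' e; apply: zi; by rewrite e.
Qed.

Lemma card_zset_meet (W : {set P * R}) m : #|W| <= t -> m <= t ->
  #|[set z : {ffun 'I_t -> P * R} | m <= #|W :&: zset z|]| <= 2 ^ t * (t ^ t * kk ^ (t - m)).
Proof.
move=> Wt mt; pose F (S : {set 'I_t}) : {set {ffun 'I_t -> P * R}} :=
  [set z : {ffun 'I_t -> P * R} | [forall i, z i \in if i \in S then W else setT]].
apply: leq_trans (_ : #|\bigcup_(S in [set S : {set 'I_t} | m <= #|S|]) F S| <= _).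
  apply/subset_leq_card/subsetP => z; rewrite inE => mz.
  apply/bigcupP; exists [set i | z i \in W].
    rewrite inE; apply: leq_trans mz _.
    apply: leq_trans (leq_imset_card z _); apply: subset_leq_card.
    apply/subsetP => p /setIP[pW /imsetP[i _ pE]]; apply/imsetP; exists i => //.
    by rewrite inE -pE.
  by rewrite inE; apply/forallP => i; rewrite inE; case: ifP; rewrite ?in_setT.
apply: leq_trans (card_bigcup_le (m := t ^ t * kk ^ (t - m)) _) _; last first.
  rewrite leq_mul2r; apply/orP; right; apply: leq_trans (max_card _) _.
  by rewrite -cardsT -powersetT card_powerset cardsT card_ord.
move=> S; rewrite inE => mS; rewrite card_ffun_forall.
rewrite (bigID (fun i => i \in S)) /=.
have kk0 : 0 < kk.
  rewrite muln_gt0; apply/andP; split; first by apply: leq_trans M_ge_E; lia.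
  by apply: leq_trans q_ge; rewrite expn_gt0.
apply: leq_mul.
  apply: leq_trans (_ : \prod_(i in S) t <= _); first by apply: leq_prod => i ->.
  rewrite prod_nat_const leq_pexp2l //; first by lia.
  by rewrite -[X in _ <= X]card_ord max_card.
rewrite (eq_bigr (fun=> kk)) => [|i /negPf->]; last by rewrite cardsT card_prod.
rewrite prod_nat_const leq_pexp2l //.
have := cardC S; rewrite card_ord => cS.
by apply: leq_trans (_ : #|[predC S]| <= _); [apply: subset_leq_card; apply/subsetP | lia].
Qed.

(** Level [j] has at most [kk ^ (2 * j)] contexts and of order [kk ^ (t - 2 * j - 2)] tuples, so
    every level contributes the same order [kk ^ (t - 2)]. *)
Lemma card_conflict (y : cand) : injective (fun i => (y.2 i).1) ->
  #|[set y' | conflict y y']| <= H.+1 * (2 ^ t * t ^ t * kk ^ (t - 2)).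
Proof.
move=> yi; pose F (j : 'I_H.+1) : {set cand} :=
  setX [set k : ctx | drop j k == drop j y.1]
       [set z : {ffun 'I_t -> P * R} | j.*2.+2 <= #|zset y.2 :&: zset z|].
apply: leq_trans (_ : #|\bigcup_(j in [set: 'I_H.+1]) F j| <= _).
  apply/subset_leq_card/subsetP => y'; rewrite inE => /existsP[j /andP[dj cj]].
  by apply/bigcupP; exists j => //; rewrite !inE eq_sym dj.
apply: leq_trans (card_bigcup_le (m := 2 ^ t * t ^ t * kk ^ (t - 2)) _) _; last first.
  by rewrite cardsT card_ord.
move=> j _.
have jH : j <= H by rewrite -ltnS.
rewrite cardsX; have [jt|tj] := leqP j.*2.+2 t; last first.
  rewrite [[set z : {ffun 'I_t -> P * R} | _ <= _]](_ : _ = set0) ?cards0 ?muln0 //.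
  apply/setP => z.
  rewrite !inE; apply/negbTE; rewrite -ltnNge; apply: leq_trans tj.
  by rewrite ltnS; apply: leq_trans (eq_leq (card_zset yi)); rewrite subset_leq_card // subsetIl.
have cz : #|zset y.2| <= t by rewrite card_zset.
have h1 : #|[set k : ctx | drop j k == drop j y.1]| <= (kk ^ 2) ^ j.
  apply: leq_trans (card_tuple_drop _ jH) _.
  case: (nat_of_ord j) => [|n]; rewrite ?expn0 // leq_exp2r // !card_prod expnMn.
  by rewrite leq_mul2r -NM leq_pmull ?orbT // muln_gt0; lia.
apply: leq_trans (leq_mul h1 (card_zset_meet cz jt)) _.
rewrite mulnC -!mulnA !leq_mul2l -expnM -expnD; apply/orP; right; apply/orP; right.
rewrite leq_eqVlt; apply/orP; left; apply/eqP; congr (_ ^ _); lia.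
Qed.

Definition cands : {set cand} :=
  [set y : cand | deficient (ctx_labels y.1) && generic (ctx_coefs y.1) y.2].

(** Averaging: contexts that are not deficient have density above [1 - 1 / (2 * E)], while the mean
    is at most [1 - 1 / E]. *)
Lemma card_deficient : E * total A + #|C| ^ H.+1 <= E * #|C| ^ H.+1 ->
  #|C| ^ H <= 2 * E * #|[set c | deficient c]|.
Proof.
move=> Etot; have C0 : 0 < #|C|.
  have : 0 < #|P| ^ 2 by rewrite expn_gt0; apply/orP; left; apply: leq_trans M_ge_E; lia.
  by rewrite -NM; case: #|C|; rewrite ?muln0.
have h : (2 * E - 1) * #|C| * #|~: [set c | deficient c]| <= 2 * E * total A.
  rewrite mulnC -sum_nat_const /total big_distrr /= big_mkcond /=.
  apply: leq_sum => c _; case: ifP => //; rewrite !inE /deficient.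
  by rewrite mulnBl mul1n -ltnNge => h; rewrite leq_subLR addnC ltnW.
have tot := cardsC [set c | deficient c]; rewrite card_tuple in tot.
have : #|C| * ((2 * E - 1) * #|~: [set c | deficient c]|) <= #|C| * ((2 * E - 2) * #|C| ^ H).
  rewrite mulnA [#|C| * (_ - _)]mulnC; apply: leq_trans h _.
  by rewrite mulnCA -expnS mulnBl; lia.
rewrite leq_pmul2l //; move: tot; move: (#|C| ^ H) (#|~: _|) (#|[set c | _]|).
move=> a b d <-; have [e ->] : exists e, E = e.+1 by exists E.-1; lia.
have -> : 2 * e.+1 - 1 = 2 * e + 1 by lia.
have -> : 2 * e.+1 - 2 = 2 * e by lia.
lia.
Qed.

Lemma card_cands : E * total A + #|C| ^ H.+1 <= E * #|C| ^ H.+1 ->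
  #|{: C * (R * R)}| ^ H * kk ^ t <= 4 * E * #|cands|.
Proof.
move=> /card_deficient cdef.
have ck : #|[set k : ctx | deficient (ctx_labels k)]| * kk ^ t <= 2 * #|cands|.
  have -> : #|cands| = \sum_(k : ctx | deficient (ctx_labels k))
      #|[set z | generic (ctx_coefs k) z]|.
    rewrite -sum1_card (partition_big (fun y : cand => y.1)
      (fun k => deficient (ctx_labels k))) /=; last by move=> y; rewrite inE => /andP[].
    apply: eq_bigr => k kd; rewrite -sum1_card.
    rewrite (reindex_onto (fun z => (k, z)) (fun y : cand => y.2)) /=.
      by apply: eq_bigl => z; rewrite !inE /= kd !eqxx !andbT.
    by move=> [k' z] /andP[_ /= /eqP ->].
  rewrite -sum_nat_const big_distrr /=.
  under eq_bigl do rewrite inE.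
  by apply: leq_sum => k _; apply: card_generic.
have cs : #|[set k : ctx | deficient (ctx_labels k)]| =
    #|{: R * R}| ^ H * #|[set c | deficient c]|.
  rewrite -[#|[set c | _]|]sum1_card big_mkcond.
  rewrite -(sum_tuple_fst _ (fun c => if c \in [set c | deficient c] then 1 else 0)).
  by rewrite -sum1_card big_mkcond; apply: eq_bigr => k _; rewrite !inE.
rewrite cs in ck; rewrite card_prod expnMn.
move: ck cdef; move: (#|cands|) (#|[set c | _]|) (_ ^ H) (_ ^ H) (kk ^ t) => a b c d e h1 h2.
have h3 : c * d * e <= 2 * E * b * d * e by rewrite !leq_mul2r h2 !orbT.
have h4 : 2 * E * (d * b * e) <= 2 * E * (2 * a) by rewrite leq_mul2l h1 orbT.
apply: leq_trans h3 _; have -> : 2 * E * b * d * e = 2 * E * (d * b * e) by ring.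
by apply: leq_trans h4 _; rewrite mulnA [2 * E * 2]mulnAC.
Qed.

Lemma exists_good_perms : exists f : {ffun H.+1.-tuple (R * R) -> {perm P}},
  #|cands| <= K ^ (2 ^ t) * #|[set y in cands | compat f y.1 y.2]|.
Proof.
apply/existsP; apply: contraT; rewrite negb_exists => /forallP nf.
pose FF := {ffun H.+1.-tuple (R * R) -> {perm P}}.
have FF0 : 0 < #|{: FF}| by apply/card_gt0P; exists [ffun=> 1%g].
have dc := sum_card_exchange cands (fun (f : FF) (y : cand) => compat f y.1 y.2).
have h1 : #|cands| * #|{: FF}| <=
    K ^ (2 ^ t) * \sum_(f : FF) #|[set y in cands | compat f y.1 y.2]|.
  rewrite dc big_distrr /= -sum_nat_const; apply: leq_sum => y.
  by rewrite inE => /andP[]; apply: card_compat.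
have h2 : K ^ (2 ^ t) * \sum_(f : FF) #|[set y in cands | compat f y.1 y.2]| + #|{: FF}| <=
   #|cands| * #|{: FF}|.
  rewrite [#|cands| * _]mulnC -[X in _ + X]muln1 -!sum_nat_const big_distrr -big_split /=.
  by apply: leq_sum => f _; rewrite addn1 ltnNge.
by lia.
Qed.

(** The blow-up keeps the density of [A]. A positive proportion of all candidates is compatible with
    it, and each has [O(kk ^ (t - 2))] conflicts, so a conflict-free family adds at least [1 / G] to
    the density. [G] depends on [t], [H] and [E] only, which permits iteration. *)
Lemma improve_step : E * total A + #|C| ^ H.+1 <= E * #|C| ^ H.+1 ->
  let G := 4 * E * K ^ (2 ^ t) * H.+1 * 2 ^ t * t ^ t in
  exists A' : ctx -> {set {set P * R}}, tree_packing t A' /\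
    G * (#|{: R * R}| ^ H.+1 * total A) + #|{: C * (R * R)}| ^ H.+1 <= G * total A'.
Proof.
move=> Etot G; have [f fc] := exists_good_perms.
set X := [set y in cands | _] in fc.
have Xinj y : y \in X -> injective (fun i => (y.2 i).1).
  by rewrite !inE => /andP[/andP[_ /andP[/injectiveP]]].
have Xrefl : {in X, reflexive conflict}.
  move=> y /Xinj yi; apply/existsP; exists ord0.
  by rewrite !drop0 eqxx setIid card_zset.
have XD y : y \in X -> #|[set y' in X | conflict y y']| <= H.+1 * (2 ^ t * t ^ t * kk ^ (t - 2)).
  move=> /Xinj yi; apply: leq_trans (card_conflict yi); apply: subset_leq_card.
  by apply/subsetP => y'; rewrite !inE => /andP[].
have [B [BX Bind BD]] := exists_independent conflict_sym Xrefl XD.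
have Binj y : y \in B -> injective (fun i => (y.2 i).1).
  by move=> /(subsetP BX); apply: Xinj.
pose Bk (k : ctx) : {set {ffun 'I_t -> P * R}} := [set z | (k, z) \in B].
pose A' (k : ctx) := blowup A x f k :|: [set zset z | z in Bk k].
have nconf y y' j : y \in B -> y' \in B -> y != y' -> j <= H ->
    drop j y.1 = drop j y'.1 -> #|zset y.2 :&: zset y'.2| <= j.*2.+1.
  move=> yB y'B ne jH dj; rewrite leqNgt; apply: contra (Bind _ _ yB y'B ne) => big.
  by apply/existsP; exists (Ordinal (n := H.+1) jH); rewrite /= dj eqxx.
have ncomp k z k' T j : z \in Bk k -> T \in blowup A x f k' -> j <= H ->
    drop j k' = drop j k -> #|zset z :&: T| <= j.*2.+1.
  rewrite inE => /(subsetP BX); rewrite inE => /andP[_ /forallP/(_ _)/forallP h] TA jH dj.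
  have /implyP := h (Ordinal (n := H.+1) jH) k'; rewrite /= dj eqxx => /(_ isT)/forall_inP.
  exact.
have bpack := blowup_pack xunit Apack f.
exists A'; split.
  split=> [k T|k k' T T' j].
    case/setUP => [|/imsetP[z zB ->]]; first exact: bpack.1.
    by rewrite card_zset //; apply: (Binj (k, z)); rewrite inE in zB.
  case/setUP => [TA|/imsetP[z zB ->]]; case/setUP => [TA'|/imsetP[z' zB' ->]] ne jH dj.
  - exact: (bpack.2 k k').
  - by rewrite setIC; apply: (ncomp k' z' k).
  - by apply: (ncomp k z k').
  - rewrite !inE in zB zB'; apply: (nconf (k, z) (k', z')) => //.
    by apply: contraNneq ne => -[-> ->].
have totA' : total A' = #|{: R * R}| ^ H.+1 * total A + #|B|.
  have -> : #|B| = \sum_(k : ctx) #|Bk k|.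
    rewrite -sum1_card (partition_big (fun y : cand => y.1) predT) //=.
    apply: eq_bigr => k _; rewrite -sum1_card.
    rewrite (reindex_onto (fun z => (k, z)) (fun y : cand => y.2)) /=.
      by apply: eq_bigl => z; rewrite !inE /= !eqxx !andbT.
    by move=> [k' z] /andP[_ /= /eqP ->].
  have -> : #|{: R * R}| ^ H.+1 * total A = \sum_(k : ctx) #|blowup A x f k|.
    under [RHS]eq_bigr do rewrite (card_blowup xunit Apack t_ge2).
    rewrite -big_distrr /= (sum_tuple_fst _ (fun c => #|A c|)) expnS mulnA.
    by rewrite !card_prod.
  rewrite /total -big_split /=; apply: eq_bigr => k _.
  have -> : #|Bk k| = #|[set zset z | z in Bk k]|.
    rewrite card_in_imset // => z z' zB zB' zz; apply/eqP; apply: contraT => ne.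
    rewrite !inE in zB zB'.
    have := nconf (k, z) (k, z') 0 zB zB'; rewrite xpair_eqE eqxx /= => /(_ ne isT erefl).
    by rewrite zz setIid card_zset; [lia | apply: (Binj (k, z'))].
  (* A new block is not a lifted one, as it would meet itself in [t > 1] points. *)
  rewrite cardsU (_ : _ :&: _ = set0) ?cards0 ?subn0 //.
  apply/setP => T; rewrite !inE; apply/negP => /andP[TA /imsetP[z zB Tz]].
  have := ncomp k z k T 0 zB TA isT erefl.
  by rewrite -Tz setIid (bpack.1 _ _ TA); lia.
rewrite totA' mulnDr leq_add2l.
have kk0 : 0 < kk ^ (t - 2).
  rewrite expn_gt0 muln_gt0; apply/orP; left; apply/andP; split.
    by apply: leq_trans M_ge_E; rewrite muln_gt0.
  by apply: leq_trans q_ge; rewrite expn_gt0.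
have hC := card_cands Etot.
rewrite -(leq_pmul2r kk0).
have h1 : #|{: C * (R * R)}| ^ H * kk ^ t <=
    4 * E * (K ^ (2 ^ t) * (#|B| * (H.+1 * (2 ^ t * t ^ t * kk ^ (t - 2))))).
  apply: leq_trans hC _; rewrite leq_mul2l; apply/orP; right.
  by apply: leq_trans fc _; rewrite leq_mul2l BD orbT.
have -> : G * #|B| * kk ^ (t - 2) =
    4 * E * (K ^ (2 ^ t) * (#|B| * (H.+1 * (2 ^ t * t ^ t * kk ^ (t - 2))))).
  by rewrite /G; ring.
apply: leq_trans h1; rewrite expnSr -mulnA leq_mul2l; apply/orP; right.
rewrite -{2}(subnKC t_ge2) expnD leq_mul2r; apply/orP; right.
by rewrite !card_prod expnMn leq_mul2r -NM leq_pmull ?orbT // muln_gt0 subn_gt0 t_ge2 ltnW.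
Qed.

End Improve.

(** * Dense and complete tree packings *)

(** A difference of two ranks divides the factorial of [#|P|], so it is prime to the modulus.
    Varying [r] gives ring sizes in arithmetic progression, whose consecutive ratios tend to 1. *)
Lemma Zp_unit_points (P : finType) r : 0 < r ->
  exists x : P -> 'Z_(#|P|`! * r).+1,
    forall i j, i != j -> (x i - x j)%R \is a GRing.unit.
Proof.
move=> r0; set q := (#|P|`! * r).+1.
have q1 : 1 < q by rewrite ltnS muln_gt0 fact_gt0.
have dunit (a b : nat) : a < b < #|P| -> (b%:R - a%:R : 'Z_q)%R \is a GRing.unit.
  case/andP => ab bP; rewrite -GRing.natrB ?(ltnW ab) // unitZpE //.
  have [k kE] : exists k, #|P|`! * r = k * (b - a).
    apply/dvdnP/dvdn_mulr/dvdn_fact; lia.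
  by rewrite /q kE -addn1 coprime_sym /coprime gcdnMDl gcdn1.
exists (fun p => (enum_rank p)%:R%R) => i j ij.
have rij : enum_rank i != enum_rank j :> nat.
  by apply: contra ij => /eqP/ord_inj/enum_rank_inj/eqP.
case: (ltngtP (enum_rank j) (enum_rank i)) rij => // h _.
  by apply: dunit; rewrite h ltn_ord.
by rewrite -GRing.opprB GRing.unitrN; apply: dunit; rewrite h ltn_ord.
Qed.

Lemma card_Zp_succ m : 0 < m -> #|'Z_m.+1| = m.+1.
Proof. by case: m => // m _; rewrite card_ord. Qed.

(** Each improvement adds at least [1 / G] to the density with the same [G]; as the density is at
    most 1, [G.+1] increments are impossible. *)
Lemma exists_dense_packing t H E : 2 <= t -> 0 < E ->
  exists (C P : finType) (A : H.-tuple C -> {set {set P}}),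
    [/\ tree_packing t A, t * (t - 1) * #|C| = #|P| ^ 2, 4 * (t ^ 3 + E) <= #|P| &
        E * #|C| ^ H.+1 < E * total A + #|C| ^ H.+1].
Proof.
move=> t2 E0; pose G := 4 * E * (4 * E * t) ^ (2 ^ t) * H.+1 * 2 ^ t * t ^ t.
have t0 : 0 < t * (t - 1) by rewrite muln_gt0; lia.
have step m : exists (C P : finType) (A : H.-tuple C -> {set {set P}}),
    [/\ tree_packing t A, t * (t - 1) * #|C| = #|P| ^ 2,
        4 * (t ^ 3 + E) <= #|P| &
        E * #|C| ^ H.+1 < E * total A + #|C| ^ H.+1 \/
        m * #|C| ^ H.+1 <= G * total A].
  elim: m => [|m [C [P [A [Apack NM ME [dense|mG]]]]]].
  (* The empty packing, on sizes that satisfy the relation between labels and points exactly. *)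
  - pose m0 := 4 * (t ^ 3 + E).
    exists 'I_(t * (t - 1) * m0 * m0), 'I_(t * (t - 1) * m0), (fun=> set0).
    rewrite !card_ord.
    have m0le : m0 <= t * (t - 1) * m0 by rewrite leq_pmull.
    split; try by [lia | right; rewrite mul0n].
      by split=> [k T|k k' T T' j]; rewrite inE.
  - by exists C, P, A; split=> //; left.
  have [le|lt] := leqP (E * total A + #|C| ^ H.+1) (E * #|C| ^ H.+1); last first.
    by exists C, P, A; split=> //; left.
  have r0 : 0 < 2 ^ t.+2 by rewrite expn_gt0.
  have P0 : 0 < #|P| by lia.
  have [x xunit] := Zp_unit_points P r0.
  have cR : #|'Z_(#|P|`! * 2 ^ t.+2).+1| = (#|P|`! * 2 ^ t.+2).+1.
    by rewrite card_Zp_succ // muln_gt0 fact_gt0.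
  set R := 'Z_(#|P|`! * 2 ^ t.+2).+1 in x xunit cR.
  have qge : 2 ^ t.+2 <= #|R|.
    by rewrite cR -addn1 leqW // leq_pmull // fact_gt0.
  have R0 : 0 < #|R| by rewrite cR.
  have [Mt ME'] : 4 * t ^ 3 <= #|P| /\ 4 * E <= #|P| by split; lia.
  have [A' [A'pack A'branch_count]] := improve_step xunit Apack t2 E0 NM Mt ME' qge le.
  exists _, _, A'; split=> //.
  - by rewrite !card_prod mulnA NM expnMn -mulnn.
  - by rewrite card_prod; apply: leq_trans ME _; rewrite leq_pmulr.
  right; apply: leq_trans A'branch_count; rewrite mulSn addnC leq_add2r -/G.
  rewrite mulnCA [#|{: C * _}|]card_prod expnMn [_ ^ _ * _ ^ _]mulnC mulnCA.
  by rewrite leq_mul2l mG orbT.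
have [C [P [A [Apack NM ME]]]] := step G.+1.
have P0 : 0 < #|P| by lia.
have G0 : 0 < G by rewrite /G !muln_gt0 !expn_gt0 !muln_gt0 E0 /=; lia.
have C0 : 0 < #|C| ^ H.+1.
  rewrite expn_gt0; apply/orP; left.
  have : 0 < #|P| ^ 2 by rewrite expn_gt0 P0.
  by rewrite -NM; case: #|C|; rewrite ?muln0.
case=> [dense|mG]; exists C, P, A; split=> //.
have := total_le Apack t2 NM erefl => h.
have : G * total A <= G * #|C| ^ H.+1 by rewrite leq_mul2l h orbT.
rewrite mulSn in mG; lia.
Qed.

(** * Pruning a dense packing to uniform branching *)

Section Branching.
Variables (n N W : nat) (C B : finType) (A : seq C -> {set B}).
Hypothesis cC : #|C| = N.
Hypothesis nN : W * n + N <= W * N.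
Hypothesis AN : forall p, #|A p| <= N.

(** The property is hereditary, so a complete [n]-ary tree can be chosen greedily from the root,
    with blocks as its last level. *)
Fixpoint big_branch k (p : seq C) : bool :=
  if k is k'.+1 then n <= #|[set c | big_branch k' (c :: p)]| else n <= #|A p|.

Fixpoint branch_count k (p : seq C) : nat :=
  if k is k'.+1 then \sum_(c : C) branch_count k' (c :: p) else #|A p|.

Lemma branch_count_le k p : branch_count k p <= N ^ k.+1.
Proof.
elim: k p => [|k IH] p /=; first by rewrite expn1.
by rewrite expnS -cC -sum_nat_const; apply: leq_sum => c _; rewrite cC.
Qed.

(** With fewer than [n] good children, at least [N / W] are bad; each bad child lacks a proportion
    [1 / W ^ k.+1] of its blocks, so the parent lacks [1 / W ^ k.+2]. *)
Lemma big_branch_of_count k p :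
  W ^ k.+1 * N ^ k.+1 < W ^ k.+1 * branch_count k p + N ^ k.+1 -> big_branch k p.
Proof.
elim: k p => [|k IH] p.
  rewrite /= !expn1 => h; have W0 : 0 < W.
    by rewrite lt0n; apply/eqP => W0; move: nN h; rewrite W0; lia.
  rewrite -(leq_pmul2l W0); lia.
apply: contraTT => /=; rewrite -ltnNge -leqNgt; set D := [set c | _] => Dn.
have h1 : W ^ k.+1 * (\sum_(c : C) branch_count k (c :: p)) + #|~: D| * N ^ k.+1 <=
          W ^ k.+1 * N ^ k.+2.
  rewrite -sum_nat_const big_distrr [X in _ + X]big_mkcond -big_split /=.
  rewrite [N ^ k.+2]expnS mulnCA -[X in X * _]cC -sum_nat_const; apply: leq_sum => c _.
  rewrite inE; have [cD|cD] := boolP (c \in D) => /=.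
    by rewrite addn0 leq_mul2l branch_count_le orbT.
  by rewrite leqNgt; apply: contra cD => /IH; rewrite inE.
have h2 : N <= W * #|~: D|.
  have := cardsC D; rewrite cC => cD; move: nN.
  have cW : W * #|D| + W * #|~: D| = W * N by rewrite -mulnDr cD.
  have : W * #|D| <= W * n by rewrite leq_mul2l (ltnW Dn) orbT.
  lia.
have h3 : N * N ^ k.+1 <= W * #|~: D| * N ^ k.+1 by rewrite leq_mul2r h2 orbT.
rewrite [W ^ k.+2]expnS [X in _ + X]expnS -!mulnA.
have h4 : W * (W ^ k.+1 * (\sum_(c : C) branch_count k (c :: p)) + #|~: D| * N ^ k.+1) <=
     W * (W ^ k.+1 * N ^ k.+2) by rewrite leq_mul2l h1 orbT.
rewrite mulnDr mulnA in h4; apply: leq_trans h4; rewrite mulnA leq_add2l.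
by rewrite mulnA.
Qed.

Lemma branch_countE k p : branch_count k p = \sum_(s : k.-tuple C) #|A (s ++ p)|.
Proof.
elim: k p => [|k IH] p.
  rewrite (bigD1 [tuple]) //= big1 ?addn0 // => s /eqP[]; exact: tuple0.
rewrite /=; under eq_bigr do rewrite IH.
rewrite (pair_big xpredT xpredT (fun (c : C) (s : k.-tuple C) => #|A (s ++ c :: p)|)) /=.
pose h (y : C * k.-tuple C) : k.+1.-tuple C := [tuple of rcons y.2 y.1].
have hinj : injective h.
  by move=> [c s] [c' s'] /(congr1 val) /= /rcons_inj[/val_inj -> ->].
have hbij : bijective h.
  by apply: inj_card_bij => //; rewrite card_prod !card_tuple expnS.
rewrite [RHS](reindex h) /=; last exact: onW_bij.
by apply: eq_bigr => y _; rewrite cat_rcons.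
Qed.

End Branching.

(** The good children at each node of the pruned tree are numbered by ['I_n]; the head of a word
    numbers a block, its tail the ancestors. *)
Lemma exists_complete_packing t H n W (C P : finType)
    (A : H.-tuple C -> {set {set P}}) :
  tree_packing t A -> 2 <= t -> t * (t - 1) * #|C| = #|P| ^ 2 -> 0 < #|C| ->
  W * n + #|C| <= W * #|C| ->
  W ^ H.+1 * #|C| ^ H.+1 < W ^ H.+1 * total A + #|C| ^ H.+1 ->
  exists phi : seq 'I_n -> {set P},
    (forall w, size w = H.+1 -> #|phi w| = t) /\
    (forall w w' j, size w = H.+1 -> size w' = H.+1 -> w != w' -> j <= H ->
      drop j.+1 w = drop j.+1 w' -> #|phi w :&: phi w'| <= j.*2.+1).
Proof.
move=> Apack t2 NM C0 nN dense; have [c0 _] := card_gt0P C0.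
pose A' (s : seq C) := oapp A set0 (insub s).
have A'E (k : H.-tuple C) : A' k = A k by rewrite /A' valK.
have A'N p : #|A' p| <= #|C|.
  rewrite /A'; case: insubP => [k _ _|_] /=; last by rewrite cards0.
  exact: (card_pack_leN Apack k t2 NM).
have gH : big_branch n A' H [::].
  apply: (big_branch_of_count erefl nN A'N); rewrite branch_countE.
  by under eq_bigr do rewrite cats0 A'E.
pose nx k p := enum [set c | big_branch n A' k (c :: p)].
(* Words are decoded from the root, so equal tails give equal contexts. *)
pose fix ctx (w : seq 'I_n) : seq C :=
  if w is b :: w' then nth c0 (nx (H - (size w').+1) (ctx w')) b :: ctx w' else [::].
have sctx w : size (ctx w) = size w by elim: w => //= b w ->.
have gctx w : size w <= H -> big_branch n A' (H - size w) (ctx w).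
  elim: w => [|b w IH] /= sw; first by rewrite subn0.
  have := IH (ltnW sw); rewrite -[H - size w](@prednK _) ?subn_gt0 // -subnS /= => g.
  have : nth c0 (nx (H - (size w).+1) (ctx w)) b \in nx (H - (size w).+1) (ctx w).
    by rewrite mem_nth // -cardE (leq_trans (ltn_ord b)).
  by rewrite mem_enum inE.
have dctx w i : drop i (ctx w) = ctx (drop i w) by elim: w i => [|b w IH] [|i] //=.
have ictx w w' : size w <= H -> size w = size w' -> ctx w = ctx w' -> w = w'.
  elim: w w' => [|b w IH] [|b' w'] //= sw [sz] [Eb Ec].
  have Ew := IH w' (ltnW sw) sz Ec; subst w'; congr (_ :: _); apply: ord_inj.
  have := gctx w (ltnW sw); rewrite -[H - size w](@prednK _) ?subn_gt0 // -subnS /= => g.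
  apply/eqP; rewrite -(nth_uniq c0 (s := nx (H - (size w).+1) (ctx w))) ?enum_uniq ?Eb //.
    by rewrite -cardE (leq_trans (ltn_ord b)).
  by rewrite -cardE (leq_trans (ltn_ord b')).
pose phi (w : seq 'I_n) : {set P} :=
  if w is b :: w' then nth set0 (enum (A' (ctx w'))) b else set0.
have Actx w : size w = H -> exists2 k : H.-tuple C, ctx w = k & n <= #|A k|.
  move=> sw; have sz : size (ctx w) == H by rewrite sctx sw.
  exists (Tuple sz) => //; have := gctx w; rewrite sw subnn leqnn /= => /(_ isT).
  by rewrite -(A'E (Tuple sz)).
have phiA b w : size w = H -> exists2 k : H.-tuple C, ctx w = k & phi (b :: w) \in A k.
  move=> /Actx[k Ek nk]; exists k => //; rewrite /phi Ek A'E -mem_enum mem_nth //.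
  by rewrite -cardE (leq_trans (ltn_ord b)).
exists phi; split.
  by case=> [//|b w [sw]]; have [k _ /Apack.1] := phiA b w sw.
case=> [//|b w] [//|b' w'] j [sw] [sw'] ne jH /= dj.
have [k Ek Tk] := phiA b w sw; have [k' Ek' Tk'] := phiA b' w' sw'.
apply: (Apack.2 k k') => //; last by rewrite -Ek -Ek' !dctx dj.
apply: contra ne => /eqP[Ekk ET].
have Ew : w = w' by apply: ictx; rewrite ?sw ?sw' // Ek Ek' Ekk.
subst w'; apply/eqP; congr (_ :: _); apply: ord_inj.
have [k2 Ek2 nk2] := Actx w sw.
rewrite Ek2 A'E in ET; apply/eqP.
rewrite -(nth_uniq set0 (s := enum (A k2))) ?enum_uniq ?ET //.
  by rewrite -cardE (leq_trans (ltn_ord b)).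
by rewrite -cardE (leq_trans (ltn_ord b')).
Qed.

(** * Colouring label chains *)

Fixpoint chain_valid (L : Type) (al : seq L -> L -> bool) (g : seq L) : bool :=
  if g is l :: u then al u l && chain_valid al u else true.

Lemma chain_valid_cat (L : Type) (al : seq L -> L -> bool) (p c : seq L) :
  chain_valid al (p ++ c) -> chain_valid al c.
Proof. by elim: p => //= l p IH /andP[_ /IH]. Qed.

Section Chains.
Variables (t H n : nat) (P : finType) (phi : seq 'I_n -> {set P}) (l0 : 'I_n).
Variables (R : finComUnitRingType) (x : P -> R).
Hypothesis xunit : forall i j, i != j -> (x i - x j)%R \is a GRing.unit.
Notation label := ('I_n * (R * R))%type.
Implicit Types (g p c u : seq label) (l : label).

(** Padding by [l0] gives vertices near the root a full list. [H.+1] labels suffice, since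
    [t <= H.*2.+3] makes the bound trivial for vertices of one level that are further apart. *)
Definition window g : seq 'I_n := take H.+1 (map fst g ++ nseq H.+1 l0).

Definition chain_block g : {set P * R} := lift_block x 1 (map snd g) (phi (window g)).

(* If [v] lies [a] levels and [w] lies [b < a] levels below a common ancestor, then
   [2b+1] common points restrict the polynomial of [v] modulo degree [2b], whatever
   the [b] labels below the ancestor of [w] are; [l] is the label of the ancestor
   of [v] at height [b], and [i = a - b - 1]. *)
Definition allowed u l : bool :=
  [forall i : 'I_t, forall b : 'I_t, forall s : b.-tuple (R * R),
   forall s' : b.-tuple (R * R),
     #|agree x (s ++ l.2 :: map snd u) (s' ++ map snd (drop i u))| <= b.*2].

Notation valid := (chain_valid allowed).

Lemma size_window g : size (window g) = H.+1.
Proof. by rewrite size_take size_cat size_nseq; case: ltnP; lia. Qed.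

(* For each second coefficient of [l] at most one first coefficient is excluded by
   given [i], [b] and [2b+1] points. *)
Lemma card_not_allowed u :
  #|[set l | ~~ allowed u l]| <= t * t * 2 ^ #|P| * (n * #|R|).
Proof.
pose bad (y : 'I_t * 'I_t * {set P}) := [set l : label | (#|y.2| == y.1.2.*2.+1) &&
  [exists s : y.1.2.-tuple (R * R), exists s' : y.1.2.-tuple (R * R),
     y.2 \subset agree x (s ++ l.2 :: map snd u) (s' ++ map snd (drop y.1.1 u))]].
apply: leq_trans (_ : #|\bigcup_(y in setT) bad y| <= _).
  apply/subset_leq_card/subsetP => l; rewrite inE => /forallPn[i /forallPn[b]].
  case/forallPn => s /forallPn[s']; rewrite -ltnNge => big.
  have [S SA cS] : exists2 S : {set P},
      S \subset agree x (s ++ l.2 :: map snd u) (s' ++ map snd (drop i u))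
      & #|S| = b.*2.+1.
    have := big; move: (agree _ _ _) => D; rewrite -bin_gt0 -cards_draws => /card_gt0P[S].
    by rewrite inE => /andP[SD /eqP cS]; exists S.
  apply/bigcupP; exists (i, b, S); rewrite ?inE //= cS eqxx /=.
  by apply/existsP; exists s; apply/existsP; exists s'.
apply: leq_trans (card_bigcup_le (m := n * #|R|) _) _; last first.
  by rewrite cardsT !card_prod !card_ord -cardsT -powersetT card_powerset cardsT.
move=> [[i b] S] _; rewrite -[n in X in _ <= X]card_ord -card_prod.
apply: (@leq_card_in _ _ (fun l : label => (l.1, l.2.2))).
move=> [m1 [a1 b1]] [m2 [a2 b2]]; rewrite !inE /=.
case/andP=> /eqP cS /existsP[s1 /existsP[s1' /subsetP h1]].
case/andP=> _ /existsP[s2 /existsP[s2' /subsetP h2]] [-> Eb]; rewrite -{}Eb in h2 *.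
congr (_, (_, _)); set v := map snd u in h1 h2; set v' := map snd _ in h1 h2.
(* Given the second coefficient of [l], only degrees up to [b.*2] can vary; the [b.*2.+1] zeros in
   [S] kill the difference, whose coefficient in degree [b.*2] is [a1 - a2]. *)
pose d := (pairpoly s1 - pairpoly s1' - (pairpoly s2 - pairpoly s2'))%R.
have sd : (size d <= b.*2)%N.
  have sp (s : b.-tuple (R * R)) : (size (pairpoly s) <= b.*2)%N.
    by have := size_pairpoly s; rewrite size_tuple.
  have sB (f h : {poly R}) m : (size f <= m -> size h <= m -> size (f - h)%R <= m)%N.
    by move=> sf sh; rewrite (leq_trans (size_polyD _ _)) // geq_max size_polyN sf.
  by apply: (sB); apply: (sB).
have D0 : (d + 'X^(b.*2) * (a1 - a2)%:P = 0)%R.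
  apply: (@poly_vanish0 _ _ x xunit _ S).
    move=> p pS; have := h1 p pS; have := h2 p pS; rewrite !inE.
    rewrite !pairpoly_cat !size_tuple /= -subr_eq0 => /eqP e2; rewrite -subr_eq0 => /eqP e1.
    have := congr2 (fun a b => a - b)%R e1 e2; rewrite subrr => <-.
    by rewrite /d !hornerE /=; ring.
  rewrite cS (leq_trans (size_polyD _ _)) // geq_max leqW //=.
  apply: leq_trans (size_polyMleq _ _) _; rewrite size_polyXn size_polyC.
  by case: (_ != _) => /=; lia.
have := congr1 (fun q : {poly R} => q`_(b.*2))%R D0.
rewrite coef0 coefD coefXnM ltnn subnn coefC eqxx nth_default // add0r.
by move/eqP; rewrite subr_eq0 => /eqP.
Qed.

Hypothesis tH : t <= H.*2.+3.
Hypothesis phi_card : forall w, size w = H.+1 -> #|phi w| = t.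
Hypothesis phi_pack : forall w w' j, size w = H.+1 -> size w' = H.+1 -> w != w' ->
  j <= H -> drop j.+1 w = drop j.+1 w' -> #|phi w :&: phi w'| <= j.*2.+1.

Lemma card_chain_block g : #|chain_block g| = t.
Proof. by rewrite card_lift_block phi_card ?size_window. Qed.

Lemma lift_block1I (s s' : seq (R * R)) (T T' : {set P}) :
  #|lift_block x 1 s T :&: lift_block x 1 s' T'| <= #|T :&: T'|.
Proof.
rewrite lift_block_capE; apply: subset_leq_card; apply/subsetP => y /imsetP[p].
have im1 (U : {set P}) : (1%g : {perm P}) @: U = U.
  by rewrite -[RHS]imset_id; apply: eq_imset => i; rewrite perm1.
move=> /setIP[/mem_lift_block[E1 _] /mem_lift_block[E2 _]] ->.
by rewrite !im1 in E1 E2; rewrite inE E1.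
Qed.

(** If the windows are equal, the coefficients differ and interpolation applies; otherwise the
    packing does, with [j = size p - 1]. *)
Lemma chain_block_same p p' c : size p = size p' -> p != p' ->
  #|chain_block (p ++ c) :&: chain_block (p' ++ c)| < (size p).*2.
Proof.
move=> sz ne; have [ht|ht] := leqP (size p).*2 t; last first.
  apply: leq_ltn_trans ht; rewrite -(card_chain_block (p ++ c)).
  by apply: subset_leq_card; apply: subsetIl.
have p0 : 0 < size p by case: p p' sz ne {ht} => [|? ?] [].
have pH : size p <= H.+1 by lia.
have dw (r : seq label) : size r = size p ->
    window (r ++ c) = map fst r ++ take (H.+1 - size p) (map fst c ++ nseq H.+1 l0).
  move=> sr; rewrite /window map_cat -catA take_cat size_map sr ltnNge pH /=.
  case: (ltngtP (size p) H.+1) pH => // pH _; by [].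
rewrite ltnNge; apply/negP => big.
have [wE|wne] := eqVneq (window (p ++ c)) (window (p' ++ c)).
  have fE : map fst p = map fst p'.
    by move/eqP: wE; rewrite !dw // eqseq_cat ?size_map // => /andP[/eqP].
  have sE : map snd (p ++ c) = map snd (p' ++ c).
    apply: (@agree_eq _ _ x xunit (size p)); first by rewrite !size_map !size_cat sz.
      by rewrite -!map_drop drop_size_cat // drop_size_cat.
    exact: leq_trans big (lift_block_agree _ _ _ _ _ _ _).
  have {}sE : map snd p = map snd p'.
    by move/eqP: sE; rewrite !map_cat eqseq_cat ?size_map // => /andP[/eqP].
  by case/eqP: ne; rewrite -[p]zip_unzip -[p']zip_unzip /unzip1 /unzip2 fE sE.
have := leq_trans big (lift_block1I _ _ _ _).
have h1 : (size p).-1 <= H by lia.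
have h2 : drop (size p) (window (p ++ c)) = drop (size p) (window (p' ++ c)).
  by rewrite !dw // !drop_size_cat ?size_map.
have := phi_pack (size_window _) (size_window _) wne h1; rewrite prednK // => /(_ h2).
lia.
Qed.

(** The blocks meet only where their polynomials agree, and the label of [p] at height [size p'] was
    allowed only if this happens in at most [2 * size p'] points. *)
Lemma chain_block_diff p p' c : size p' < size p -> valid (p ++ c) ->
  #|chain_block (p ++ c) :&: chain_block (p' ++ c)| < size p + size p'.
Proof.
move=> sz val; have [ht|ht] := leqP (size p + size p') t; last first.
  apply: leq_ltn_trans ht; rewrite -(card_chain_block (p ++ c)).
  by apply: subset_leq_card; apply: subsetIl.
rewrite ltnNge; apply/negP => big; set b := size p' in sz ht big *.
case dE : (drop b p) => [|l u]; first by move: (size_drop b p); rewrite dE /=; lia.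
have su : (size u).+1 = size p - b by rewrite -size_drop dE.
have pE : p ++ c = take b p ++ l :: (u ++ c) by rewrite -[p in LHS](cat_take_drop b) dE -catA.
have : valid (l :: (u ++ c)) by move: val; rewrite pE; apply: chain_valid_cat.
case/andP=> /forallP al _; have iu : size u < t by lia.
have bt : b < t by lia.
have st : size (map snd (take b p)) == b by rewrite size_map size_takel // ltnW.
have st' : size (map snd p') == b by rewrite size_map.
have /forallP/(_ (Ordinal bt))/forallP/(_ (Tuple st))/forallP/(_ (Tuple st')) := al (Ordinal iu).
rewrite /= drop_size_cat // -map_cons -!map_cat -pE leqNgt => /negP; apply.
apply: leq_trans (lift_block_agree x 1 _ _ 1 _ _); apply: leq_trans big; lia.
Qed.

Lemma chain_block_dist g g' p p' c : valid g -> valid g' -> g != g' ->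
  g = p ++ c -> g' = p' ++ c ->
  #|chain_block g :&: chain_block g'| < size p + size p'.
Proof.
move=> vg vg' ne E E'; subst g g'.
case: (ltngtP (size p) (size p')) => sz.
- by rewrite setIC addnC; apply: chain_block_diff.
- exact: chain_block_diff.
- rewrite -sz addnn; apply: chain_block_same => //.
  by apply: contraNneq ne => ->.
Qed.

End Chains.

(** * Label chains of trees *)

Section Tree.
Variables (V : finType) (e : rel V).
Hypothesis etree : is_tree e.

(** Parents are one step closer to a root. The parent edges already connect the graph, so any other
    edge would close a cycle. *)
Lemma tree_parents : exists (r : V) (par : V -> V) (dep : V -> nat),
  [/\ dep r = 0, forall v, v != r -> e (par v) v /\ dep v = (dep (par v)).+1 &
      forall u v, e u v -> (u != r /\ v = par u) \/ (v != r /\ u = par v)].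
Proof.
have [[esym eirr] [V0 econ] eacyc] := etree.
have [r _] := card_gt0P V0; pose dep v := gdist e r v.
pose par v := odflt v [pick w | e w v & dep v == (dep w).+1].
have parP v : v != r -> e (par v) v /\ dep v = (dep (par v)).+1.
  move=> vr; rewrite /par; case: pickP => [w /andP[ew /eqP]//|np].
  have /has_walkP[p [sp pp lp]] := gdist_walk (econ r v).
  move: sp pp lp; case/lastP: p => [|p w] /=; first by move=> _ _ E; rewrite E eqxx in vr.
  rewrite size_rcons rcons_path last_rcons => sp /andP[pp ew] wv; subst w.
  have := np (last r p); rewrite ew /= => /negP[]; rewrite eqn_leq.
  apply/andP; split; last first.
    by rewrite /dep -sp ltnS; apply: gdist_le; apply/has_walkP; exists p.
  have /has_walkP[p' [sp' pp' lp']] := gdist_walk (econ r (last r p)).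
  rewrite {2}/dep -sp' -(size_rcons p' v).
  apply: gdist_le; apply/has_walkP; exists (rcons p' v).
  by rewrite rcons_path pp' lp' ew last_rcons.
exists r, par, dep; split=> //.
  apply/eqP; rewrite -leqn0; apply: gdist_le; apply/has_walkP; by exists [::].
move=> u v euv.
pose e' := [rel y z | e y z && ((y != r) && (z == par y) || (z != r) && (y == par z))].
have [//|ne'] := boolP (e' u v).
  by rewrite /= euv /= => /orP[/andP[? /eqP ?]|/andP[? /eqP ?]]; [left | right].
have e'sym : symmetric e' by move=> y z; rewrite /= esym orbC.
have e'con v1 : connect e' v1 r.
  have [m] := ubnP (dep v1); elim: m v1 => // m IH v1 dm.
  have [->|vr] := eqVneq v1 r; first exact: connect0.
  have [ep dp] := parP v1 vr.
  apply: connect_trans (IH (par v1) _); last by rewrite dp in dm.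
  by apply: connect1; rewrite /= esym ep vr eqxx.
have : connect e' u v.
  by apply: connect_trans (e'con u) _; rewrite (sym_connect_sym e'sym).
case/connectP => p0 pp0 lp0; case: (shortenP pp0) lp0 => p pp up _ lp.
have sp : 2 <= size p.
  case: p pp up lp => [|w [|w' p]] //=; first by move=> _ _ vu; rewrite vu eirr in euv.
  by rewrite andbT => e'w _ wv; case/negP: ne'; rewrite wv.
case: (eacyc (u :: p)) => //; apply/andP; split=> //=.
rewrite rcons_path -lp esym euv andbT.
by apply: sub_path pp => y z /andP[].
Qed.

Variables (L : finType) (l0 : L) (al : seq L -> L -> bool).
Hypothesis al_card : forall u, max_degree e <= #|[set l | al u l]|.

(** A vertex is numbered among the neighbours of its parent; the number is below the maximum degree,
    so it names an allowed label. *)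
Lemma tree_chains : exists ch : V -> seq L,
  [/\ injective ch, forall v, chain_valid al (ch v) &
      forall u v, e u v -> (exists l, ch u = l :: ch v) \/ (exists l, ch v = l :: ch u)].
Proof.
have [r [par [dep [depr parP edgeP]]]] := tree_parents.
pose lab v c := nth l0 (enum [set l | al c l]) (index v (enum [set y | e (par v) y])).
pose fix chn m v {struct m} :=
  if m is m'.+1 then lab v (chn m' (par v)) :: chn m' (par v) else [::].
pose ch v := chn (dep v) v.
have chr : ch r = [::] by rewrite /ch depr.
have chS v : v != r -> ch v = lab v (ch (par v)) :: ch (par v).
  by move=> vr; rewrite /ch (parP v vr).2.
have idx v c : v != r -> index v (enum [set y | e (par v) y]) < size (enum [set l | al c l]).
  move=> vr; rewrite -cardE; apply: leq_trans (al_card c).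
  apply: leq_trans (leq_bigmax (par v)); rewrite /degree cardE index_mem mem_enum inE.
  exact: (parP v vr).1.
exists ch; split.
- move=> v; have [m] := ubnP (dep v); elim: m v => // m IH v dm v'.
  have [->|vr] := eqVneq v r; have [->|vr'] := eqVneq v' r => //.
  + by rewrite chr chS.
  + by rewrite chr chS.
  rewrite chS // [ch v']chS // => -[El Ec].
  have Ep : par v = par v' by apply: IH Ec; have := (parP v vr).2; lia.
  move/eqP: El; rewrite /lab -Ec nth_uniq ?enum_uniq ?idx // Ep => /eqP Ei.
  have mv w : w != r -> w \in enum [set y | e (par w) y].
    by move=> wr; rewrite mem_enum inE (parP w wr).1.
  by rewrite -(nth_index v (mv v vr)) Ep Ei nth_index // mv.
- move=> v; have [m] := ubnP (dep v); elim: m v => // m IH v dm.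
  have [->|vr] := eqVneq v r; first by rewrite chr.
  rewrite chS //=; apply/andP; split; last by apply: IH; have := (parP v vr).2; lia.
  have : lab v (ch (par v)) \in enum [set l | al (ch (par v)) l] by rewrite mem_nth ?idx.
  by rewrite mem_enum inE.
- move=> u v /edgeP[[ur ->]|[vr ->]]; [left | right]; by eexists; apply: chS.
Qed.

(** Each step of a walk adds or removes one head label. *)
Lemma walk_common_suffix (ch : V -> seq L) p u :
  (forall u v, e u v -> (exists l, ch u = l :: ch v) \/ (exists l, ch v = l :: ch u)) ->
  path e u p -> exists q q' c, [/\ ch u = q ++ c, ch (last u p) = q' ++ c &
    size q + size q' <= size p].
Proof.
move=> che; elim: p u => [|v p IH] u /=; first by exists [::], [::], (ch u).
case/andP=> /che euv /IH[q [q' [c [Eq Eq' sq]]]].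
case: euv => [[l El]|[l El]].
  by exists (l :: q), q', c; rewrite El Eq; split.
(* If the walk ends below the child just entered, the suffix shrinks to [ch u] and [l] moves to
   [q']. *)
case: q Eq sq => [|l' q] Eq sq.
  exists [::], (rcons q' l), (ch u); rewrite Eq' size_rcons /=; split=> //.
  by rewrite cat_rcons -El Eq.
exists q, q', c; split=> //; last by move: sq => /=; lia.
by move: Eq; rewrite El => -[].
Qed.

Lemma tone_colorable_chains t (K : finType) (bl : seq L -> {set K}) :
  (forall g, #|bl g| = t) ->
  (forall g g' p p' c, chain_valid al g -> chain_valid al g' -> g != g' ->
     g = p ++ c -> g' = p' ++ c -> #|bl g :&: bl g'| < size p + size p') ->
  tone_colorable e t #|K|.
Proof.
move=> blt bld; have [ch [chinj chval che]] := tree_chains.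
apply/existsP; exists [ffun v => [set enum_rank y | y in bl (ch v)]].
apply/andP; split.
  by apply/forallP => v; rewrite ffunE card_imset ?blt //; apply: enum_rank_inj.
apply/forallP => u; apply/forallP => v; apply/implyP => uv; apply/implyP => cuv.
rewrite !ffunE -imsetI; last by move=> y z _ _; apply: enum_rank_inj.
rewrite card_imset; last exact: enum_rank_inj.
have /has_walkP[p [<- pp lp]] := gdist_walk cuv.
have [q [q' [c [Eq Eq' sq]]]] := walk_common_suffix che pp; rewrite lp in Eq'.
apply: leq_trans sq; apply: (bld _ _ _ _ c) => //.
by apply: contra uv => /eqP/chinj ->.
Qed.

End Tree.

(** * The upper bound *)

Import Order.TTheory Num.Theory.

(** One packing is fixed. The least ring size [q] of the progression with
    [n * q ^ 2 - K0 * q >= Delta] leaves enough allowed labels, and uses [#|P| * q] colours with [q]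
    close to the square root of [Delta / n]. *)
Lemma tone_number_tree_sqr t D : 2 <= t ->
  exists Delta0, forall (V : finType) (e : rel V),
    is_tree e -> Delta0 <= max_degree e ->
    D * tone_number e t ^ 2 <= D.+1 * (t * (t - 1) * max_degree e).
Proof.
(* The losses [n >= (1 - 2 / W) * N] and [(1 + 1 / W) * Delta] combine to
   [(W + 1) / (W - 2) = (D + 1) / D]. The packing has depth [H = t]. *)
move=> t2; pose W := 3 * D + 2; pose E := W ^ t.+1.
have W2D : W - 2 = 3 * D by rewrite /W addnK.
case: (posnP D) => [D0|D0]; first by exists 0 => V e _ _; rewrite D0 mul0n.
have E0 : 0 < E by rewrite expn_gt0 /W; lia.
have [C [P [A [Apack NM ME dense]]]] := exists_dense_packing t t2 E0.
have t0 : 0 < t * (t - 1) by rewrite muln_gt0; lia.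
have WE : W <= E by rewrite /E expnS leq_pmulr // expn_gt0 /W; lia.
have CW : W <= #|C|.
  rewrite -(leq_pmul2l t0) NM expnS expn1; apply: leq_mul; last by lia.
  apply: leq_trans (_ : t ^ 3 <= _); last by lia.
  rewrite !expnS expn0 muln1 leq_mul2l; apply/orP; right; nia.
set N := #|C| in NM CW dense; pose n := N - (N %/ W).+1.
have W2 : 2 <= W by rewrite /W; lia.
have NW := divn_eq N W; have NWlt : N %% W < W by rewrite ltn_mod; lia.
have NWle : (N %/ W).+1 <= N.
  have : 0 < N %/ W by rewrite divn_gt0 //; lia.
  have : 2 * (N %/ W) <= W * (N %/ W) by rewrite leq_mul2r W2 orbT.
  lia.
have En : n + (N %/ W).+1 = N by rewrite /n subnK.
have nN : W * n + N <= W * N by rewrite -[in X in _ <= X]En mulnDr leq_add2l mulnS; lia.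
have nbig : (W - 2) * N <= W * n.
  have : W * n + W * (N %/ W).+1 = W * N by rewrite -mulnDr En.
  rewrite mulnS mulnBl; lia.
have C0 : 0 < N by lia.
have [phi [phi_card phi_pack]] := exists_complete_packing Apack t2 NM C0 nN dense.
have n0 : 0 < n.
  rewrite lt0n; apply: contraTneq nbig => ->.
  by rewrite W2D muln0 -ltnNge !muln_gt0 D0 C0.
(* [K0 * #|R|] bounds the labels that are not allowed; [c] absorbs it and the growth of [n * q ^ 2]
   when [q] increases by [W0]. *)
pose W0 := #|P|`!; pose K0 := t * t * 2 ^ #|P| * n.
pose c := K0 + n * (2 * W0 + W0 ^ 2).
(* The first term excludes [r = 0]; the second makes [c * W * q'] at most [Delta]. *)
exists (n.+1 + c * W * (c * W + K0)) => V e etree; set Delta := max_degree e => Dbig.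
have W00 : 0 < W0 by rewrite fact_gt0.
pose Pr r := Delta + K0 * (W0 * r).+1 <= n * (W0 * r).+1 ^ 2.
have exPr : exists r, Pr r.
  exists (Delta + K0); rewrite /Pr; set q := (W0 * _).+1.
  have qb : Delta + K0 <= q by rewrite leqW // leq_pmull.
  apply: leq_trans (_ : q * q <= _); last by rewrite expnS expn1 leq_pmull.
  apply: leq_trans (_ : (Delta + K0) * q <= _); last by rewrite leq_mul2r qb orbT.
  by rewrite mulnDl leq_add2r leq_pmulr.
case: (ex_minnP exPr) => r rP rmin.
case: r rP rmin => [|r] rP rmin.
  move: rP; rewrite /Pr muln0 exp1n !muln1; have : n < Delta by lia.
  lia.
have nPr : n * (W0 * r).+1 ^ 2 < Delta + K0 * (W0 * r).+1.
  by rewrite ltnNge; apply/negP => /rmin; rewrite ltnn.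
have r0 : 0 < r.+1 by [].
pose R : finComUnitRingType := 'Z_(W0 * r.+1).+1.
have cR : #|R| = (W0 * r.+1).+1 by rewrite card_Zp_succ // muln_gt0 W00.
have [x xunit] : exists x : P -> R, forall i j, i != j -> (x i - x j)%R \is a GRing.unit.
  exact: Zp_unit_points.
pose l0 : 'I_n := Ordinal n0.
have al_card u : max_degree e <= #|[set l : 'I_n * (R * R) | allowed t x u l]|.
  have := cardsC [set l : 'I_n * (R * R) | allowed t x u l].
  have -> : ~: [set l : 'I_n * (R * R) | allowed t x u l] = [set l | ~~ allowed t x u l].
    by apply/setP => l; rewrite !inE.
  rewrite !card_prod card_ord cR; have := card_not_allowed t xunit u; rewrite cR.
  move: rP; rewrite /Pr -/Delta /K0 !expnS expn0 muln1.
  move: (#|_|) (#|_|) => a b; move: (W0 * _).+1 => q h1 h2 h3.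
  rewrite mulnA in h2; clear -h1 h2 h3; lia.
have tH : t <= t.*2.+3 by lia.
have col := @tone_colorable_chains V e etree _ (l0, (0%R, 0%R)) _ al_card t _
  (chain_block t phi l0 x) (card_chain_block l0 x phi_card)
  (chain_block_dist l0 xunit tH phi_card phi_pack).
have tn : tone_number e t <= #|P| * (W0 * r.+1).+1.
  by rewrite /tone_number; case: ex_minnP => m _; apply; move: col; rewrite card_prod cR.
apply: leq_trans (_ : D * (#|P| * (W0 * r.+1).+1) ^ 2 <= _).
  by rewrite leq_mul2l leq_sqr tn orbT.
rewrite expnMn -NM mulnCA [D.+1 * _]mulnCA -!mulnA leq_pmul2l; last by rewrite ltnW.
rewrite leq_pmul2l ?subn_gt0 //.
set q' := (W0 * r).+1 in nPr.
have -> : (W0 * r.+1).+1 = q' + W0 by rewrite /q' mulnS; lia.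
have q'1 : 0 < q' by [].
(* Otherwise minimality of [r] gives [q' < c * W + K0], against the threshold. *)
have cq : c * W * q' <= Delta.
  rewrite leqNgt; apply/negP => Dlt.
  have h : q' * q' < q' * (c * W + K0).
    apply: leq_ltn_trans (_ : n * q' ^ 2 < _); first by rewrite expnS expn1 leq_pmull.
    by apply: leq_trans nPr _; rewrite mulnDr mulnC [q' * K0]mulnC leq_add2r mulnC ltnW.
  rewrite ltn_pmul2l // in h.
  have h' : c * W * q' <= c * W * (c * W + K0) by rewrite leq_mul2l (ltnW h) orbT.
  by move: (leq_trans Dbig (ltnW (leq_trans Dlt h'))); rewrite addSn ltnNge leq_addl.
have h1 : n * (q' + W0) ^ 2 <= Delta + c * q'.
  apply: leq_trans (_ : n * q' ^ 2 + n * (2 * W0 + W0 ^ 2) * q' <= _).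
    rewrite sqrnD -mulnA -mulnDr leq_mul2l; apply/orP; right.
    rewrite mulnDl addnAC -addnA leq_add2l.
    by have : W0 ^ 2 * 1 <= W0 ^ 2 * q'; [rewrite leq_mul2l q'1 orbT | lia].
  by rewrite /c mulnDl; lia.
have h2 : (W - 2) * N * (q' + W0) ^ 2 <= W * n * (q' + W0) ^ 2 by rewrite leq_mul2r nbig orbT.
have h3 : W * (n * (q' + W0) ^ 2) <= W * (Delta + c * q') by rewrite leq_mul2l h1 orbT.
have h4 : 3 * (D * (N * (q' + W0) ^ 2)) <= 3 * (D.+1 * Delta).
  rewrite W2D in h2; rewrite mulnA [3 * D * _]mulnA; apply: leq_trans h2 _.
  rewrite -mulnA; apply: leq_trans h3 _; rewrite mulnDr.
  have -> : W * (c * q') = c * W * q' by ring.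
  by rewrite {1}/W; move: (c * W * q') cq => y; clear; lia.
by move: h4; rewrite leq_pmul2l // mulnCA.
Qed.

Local Open Scope ring_scope.

Theorem theorem1p4 (R : realType) (t : nat) (delta : R)
    (ht : (2 <= t)%N) (hdelta : 0 < delta) :
  exists Delta0 : nat, forall (V : finType) (e : rel V),
    is_tree e -> (Delta0 <= max_degree e)%N ->
    (tone_number e t)%:R <=
      (1 + delta) * Num.sqrt (t%:R * (t%:R - 1) * (max_degree e)%:R).
Proof.
(* With [1 / D <= delta], the factor [1 + 1 / D] is below [(1 + delta) ^ 2]. *)
pose D := Num.bound delta^-1.
have dD : 1 <= delta * D%:R.
  rewrite -ler_pdivrMl // mulr1 ltW //.
  by apply: archi_boundP; rewrite invr_ge0 ltW.
have D0 : (0 : R) < D%:R.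
  by rewrite -(pmulr_rgt0 _ hdelta); apply: lt_le_trans dD.
have [Delta0 h] := tone_number_tree_sqr D ht; exists Delta0 => V e etree eD.
have := h V e etree eD; rewrite -(ler_nat R) natrM natrX !natrM natrB ?(ltnW ht) //.
rewrite -[D.+1]addn1 natrD; set m := (tone_number e t)%:R; set X := t%:R * (t%:R - 1) * _ => hm.
have X0 : 0 <= X by rewrite !mulr_ge0 ?subr_ge0 ?ler1n // ltnW.
have m0 : 0 <= m by rewrite ler0n.
have hm' : m ^+ 2 <= (1 + delta) ^+ 2 * X.
  rewrite -(ler_pM2l D0); apply: le_trans hm _; rewrite [leRHS]mulrA ler_wpM2r //.
  have : 0 < D%:R * delta * delta by rewrite !mulr_gt0.
  by rewrite mulrC in dD; nra.
rewrite -(ler_pXn2r (n := 2)) ?nnegrE //.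
  by rewrite exprMn sqr_sqrtr.
by rewrite mulr_ge0 ?sqrtr_ge0 // addr_ge0 // ltW.
Qed.
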